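(* Let $X\subseteq\mathbb{R}^2$. The lattice $\mathscr{K}^2(X)$ is finite if and only if $X$ is equivalent to $L_n$, $T_n$, $D_{p,q}$, $I_{p,q}$ or $S_6$ for some integers $n,p,q$.
   Context: Convex hull lattice. $\mathrm{ch}$ denotes the convex hull. $\mathscr{K}^d$ is the lattice of all convex subsets of $\mathbb{R}^d$ with $A\vee B=\mathrm{ch}(A\cup B)$ and $A\wedge B=A\cap B$. For $X\subseteq\mathbb{R}^d$, $\mathscr{K}^d(X)$ is the least sublattice of $\mathscr{K}^d$ containing all singletons $\{x\}$, $x\in X$. Equivalence. For a set of points $X$ and $A\subseteq X$, put $\mathrm{Rch}_X(A)=\mathrm{ch}(A)\cap X$. Two sets of points $X,Y$ are equivalent, $X\equiv Y$, if there is a bijection $f:X\to Y$ with $f(\mathrm{Rch}_X(A))=\mathrm{Rch}_Y(f(A))$ for all $A\subseteq X$. The configurations below are considered up to equivalence. Notation: $x{-}y{-}z$ means that $x,y,z$ are distinct, collinear, and $y$ lies between $x$ and $z$; longer chains $x_1{-}\cdots{-}x_m$ mean distinct collinear points in this order on the line. Linear configuration $L_n$ ($n>0$): a set of $n$ collinear points. Triangular configuration $T_n$ ($n>1$): a set of $n$ collinear points $a_1{-}\cdots{-}a_n$ together with one extra point $s$ not collinear with them. Diamond configuration $D_{p,q}$ ($p,q\ge 0$ integers, $(p,q)\notin\{(0,0),(1,0),(0,1)\}$): a set of $p+q+3$ points in the plane consisting of $p+q+1$ collinear points $a_1{-}\cdots{-}a_p{-}c{-}b_1{-}\cdots{-}b_q$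 and two further points $s,s'$, not on the line of those points, such that the segment $ss'$ meets the axis (the segment joining the first and last of the collinear points) exactly in the point $c$, called the centre. Subdiamond configuration $I_{p,q}$ (same $p,q$): $I_{p,q}=D_{p,q}\setminus\{c\}$, where $c$ is the centre of $D_{p,q}$. Sporadic configuration $S_6$: six points $a,b,c,a',b',c'$ in the plane such that $a{-}a'{-}c'$, $b{-}b'{-}a'$ and $c{-}c'{-}b'$, with no other collinear subsets (of at least three points).
   Formalization: The set X is assumed nonempty: for the empty set the generated lattice is (trivially) finite, but X is not equivalent to any of the listed configurations, all of which are nonempty. *)

(* Defs.v *)
From mathcomp Require Import all_boot all_order all_algebra.
From mathcomp Require Import boolp classical_sets functions cardinality.
From mathcomp Require Import reals convex.

Set Implicit Arguments.
Unset Strict Implicit.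
Unset Printing Implicit Defensive.

Import Order.TTheory GRing.Theory Num.Theory.

Local Open Scope ring_scope.
Local Open Scope classical_set_scope.
Local Open Scope card_scope.

Definition ch (R : realType) (d : nat) (A : set 'rV[R]_d) : set 'rV[R]_d :=
  smallest (@convex_set R 'rV[R]_d) A.

(* [L] is (the carrier of) a sublattice of the lattice of all convex subsets
   of R^d, with meet the intersection and join [ch (A `|` B)]. *)
Definition convex_sublattice (R : realType) (d : nat)
    (L : set (set 'rV[R]_d)) : Prop :=
  [/\ forall A, L A -> convex_set A,
      forall A B, L A -> L B -> L (ch (A `|` B)) &
      forall A B, L A -> L B -> L (A `&` B)].

Definition convex_lattice (R : realType) (d : nat) (X : set 'rV[R]_d) :
    set (set 'rV[R]_d) :=
  smallest (@convex_sublattice R d) [set [set x] | x in X].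

Definition Rch (R : realType) (d : nat) (X A : set 'rV[R]_d) : set 'rV[R]_d :=
  ch A `&` X.

Definition equivalent (R : realType) (d : nat) (X Y : set 'rV[R]_d) : Prop :=
  exists f : 'rV[R]_d -> 'rV[R]_d,
    set_bij X Y f /\ forall A, A `<=` X -> f @` Rch X A = Rch Y (f @` A).

Definition collinear (R : realType) (d : nat) (A : set 'rV[R]_d) : Prop :=
  exists p u : 'rV[R]_d, u != 0 /\ A `<=` [set p + t *: u | t in setT].

(* The chain x_1 - ... - x_m: since the parameters are strictly increasing, the
   points are distinct and are met in this order along the line.  In
   particular [chain [:: x; y; z]] says that y is strictly between x and z. *)
Definition chain (R : realType) (d : nat) (s : seq 'rV[R]_d) : Prop :=
  exists (p u : 'rV[R]_d) (t : seq R),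
    [/\ u != 0, sorted <%R t & s = [seq p + x *: u | x <- t]].

Definition segment (R : realType) (d : nat) (x y : 'rV[R]_d) : set 'rV[R]_d :=
  ch [set x; y].

Definition linear_configuration (R : realType) (n : nat)
    (Y : set 'rV[R]_2) : Prop :=
  [/\ (0 < n)%N, Y #= `I_n & collinear Y].

Definition triangular_configuration (R : realType) (n : nat)
    (Y : set 'rV[R]_2) : Prop :=
  (1 < n)%N /\
  exists (a : seq 'rV[R]_2) (s : 'rV[R]_2),
    [/\ size a = n, chain a, ~ collinear [set` s :: a] & Y = [set` s :: a]].

(* [Y] is a diamond configuration with parameters p, q and centre [c]. *)
Definition diamond_with_centre (R : realType) (p q : nat) (Y : set 'rV[R]_2)
    (c : 'rV[R]_2) : Prop :=
  (p, q) \notin [:: (0, 0); (1, 0); (0, 1)]%N /\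
  exists (a b : seq 'rV[R]_2) (s s' : 'rV[R]_2),
    [/\ size a = p /\ size b = q,
        chain (a ++ c :: b),
        [/\ s != s', ~ collinear [set` s :: a ++ c :: b] &
            ~ collinear [set` s' :: a ++ c :: b]],
        segment s s' `&` segment (head c a) (last c b) = [set c] &
        Y = [set` s :: s' :: a ++ c :: b]].

Definition diamond_configuration (R : realType) (p q : nat)
    (Y : set 'rV[R]_2) : Prop :=
  exists c, diamond_with_centre p q Y c.

Definition subdiamond_configuration (R : realType) (p q : nat)
    (Y : set 'rV[R]_2) : Prop :=
  exists D c, diamond_with_centre p q D c /\ Y = D `\ c.

Definition sporadic_configuration (R : realType) (Y : set 'rV[R]_2) : Prop :=
  exists a b c a' b' c' : 'rV[R]_2,
    [/\ uniq [:: a; b; c; a'; b'; c'],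
        Y = [set` [:: a; b; c; a'; b'; c']],
        [/\ chain [:: a; a'; c'], chain [:: b; b'; a'] &
            chain [:: c; c'; b']] &
        forall A : set 'rV[R]_2, A `<=` Y -> `I_3 #<= A -> collinear A ->
          [\/ A = [set` [:: a; a'; c']], A = [set` [:: b; b'; a']] |
              A = [set` [:: c; c'; b']]]].

(* Main.v *)
Require Import Defs.
From mathcomp Require Import all_boot all_order all_algebra.
From mathcomp Require Import boolp classical_sets functions cardinality.
From mathcomp Require Import reals interval_inference convex ring lra.

(* Call a set crossing-closed if it contains the crossing point of any two of
   its segments that cross properly.  For a finite crossing-closed P the hulls
   of subsets of P are closed under intersection, so K(X) is finite as soon as
   X lies in such a P; conversely, if K(X) is finite, the points z with {z} in
   K(X) form such a P.  It remains to classify the finite crossing-closed P.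

   If P has a proper crossing, with centre o, a point of P nearest to o on one
   of the four rays shows that P lies on the two diagonals, and then extra
   points can lie on only one of them: P is part of a diamond.

   Without proper crossings P lies in a triangle abc with vertices in P (by
   Radon's theorem), and the line through any two other points of P contains a
   vertex.  Colour these pairs by the vertex.  Either one colour suffices, and
   P is part of a diamond, or there is a triangle with three colours; absence
   of crossings then forces the six points to form S_6 and excludes a seventh.

   A proper subset of S_6 is again part of a diamond, and everything involved
   is determined by which points lie in which triangles, so it is invariant
   under equivalence. *)
Set Implicit Arguments.
Unset Strict Implicit.
Unset Printing Implicit Defensive.

Import Order.TTheory GRing.Theory Num.Theory.

Local Open Scope ring_scope.
Local Open Scope classical_set_scope.
Local Open Scope card_scope.

(** All geometry is expressed by the signed area [orient] and by barycentric weights: [orient p q]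
    is affine in its third argument, so a question about the sides of a line becomes one about signs
    of weights. The families [L_n], [T_n], [D_{p,q}], [I_{p,q}] are merged into [thin], whose points
    [s] and [s'] need not belong to the set. This makes [thin] hereditary, so it passes from [P] to
    its subset [X], and the parameters with their small exceptions are sorted out only once, in
    [thin_configuration]. Equivalence is the delicate side of the converse: a hull-preserving
    bijection need not be affine, and it may send two points on one side of a line to opposite sides
    of the image line. Three points on the axis rule this out; with fewer the set has at most four
    points, and every such set is thin. *)

Definition px (R : realType) (a : 'rV[R]_2) : R := a 0 0.
Definition py (R : realType) (a : 'rV[R]_2) : R := a 0 1.

Section Coordinates.
Context {R : realType}.
Implicit Types (a b c d o p q z : 'rV[R]_2) (P : set 'rV[R]_2).

Lemma pt_eq a b : px a = px b -> py a = py b -> a = b.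
Proof.
move=> h0 h1; apply/rowP; case=> [[|[|//]]] i2.
- by rewrite (_ : Ordinal i2 = 0) //; apply: val_inj.
- by rewrite (_ : Ordinal i2 = 1) //; apply: val_inj.
Qed.

Lemma pxD a b : px (a + b) = px a + px b. Proof. by rewrite /px mxE. Qed.
Lemma pyD a b : py (a + b) = py a + py b. Proof. by rewrite /py mxE. Qed.
Lemma pxN a : px (- a) = - px a. Proof. by rewrite /px mxE. Qed.
Lemma pyN a : py (- a) = - py a. Proof. by rewrite /py mxE. Qed.
Lemma pxZ (k : R) a : px (k *: a) = k * px a. Proof. by rewrite /px mxE. Qed.
Lemma pyZ (k : R) a : py (k *: a) = k * py a. Proof. by rewrite /py mxE. Qed.
Lemma px0 : px (0 : 'rV[R]_2) = 0. Proof. by rewrite /px mxE. Qed.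
Lemma py0 : py (0 : 'rV[R]_2) = 0. Proof. by rewrite /py mxE. Qed.
Definition coordE := (pxD, pyD, pxN, pyN, pxZ, pyZ, px0, py0).

End Coordinates.

Ltac ptring := apply: pt_eq; rewrite ?coordE; ring.
Ltac ptfield := apply: pt_eq; rewrite ?coordE; field.

(** * Signed areas, segments, triangles, and Radon's theorem for four points *)

Section Radon.
Context {R : realType}.
Implicit Types (a b c d o p q z : 'rV[R]_2) (P : set 'rV[R]_2).

(** Twice the signed area of the triangle [abc]: it vanishes exactly on collinear triples and is
    affine in each argument. *)
Definition orient a b c : R :=
  (px b - px a) * (py c - py a) - (py b - py a) * (px c - px a).

Definition seg a b : set 'rV[R]_2 :=
  [set z | exists t : R, [/\ 0 <= t, t <= 1 & z = (1 - t) *: a + t *: b]].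

(** Strictness concerns the parameter only: [a = b] is allowed and forces [o = a]. In [cross] the
    nonzero area excludes this for both diagonals. *)
Definition btw a o b : Prop :=
  exists t : R, [/\ 0 < t, t < 1 & o = (1 - t) *: a + t *: b].

(** Degenerate triangles are included on purpose: [tri a a b] is the segment, so facts about
    triangles also serve segments. *)
Definition tri a b c : set 'rV[R]_2 :=
  [set z | exists x y w : R, [/\ 0 <= x, 0 <= y, 0 <= w, x + y + w = 1 &
                                 z = x *: a + y *: b + w *: c]].

(* The diagonals ac and bd of a strictly convex quadrilateral meet in o. *)
Definition cross a b c d o : Prop :=
  [/\ btw a o c, btw b o d & orient a b c != 0].

Definition cross_closed P : Prop :=
  forall a b c d o, P a -> P b -> P c -> P d -> cross a b c d o -> P o.

Definition cross_free P : Prop :=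
  forall a b c d o, P a -> P b -> P c -> P d -> ~ cross a b c d o.


Lemma orient_rot a b c : orient a b c = orient b c a.
Proof. by rewrite /orient; ring. Qed.

Lemma orient_swap a b c : orient a b c = - orient b a c.
Proof. by rewrite /orient; ring. Qed.

Lemma orient_comb (x y w : R) p q a b c : x + y + w = 1 ->
  orient p q (x *: a + y *: b + w *: c) =
  x * orient p q a + y * orient p q b + w * orient p q c.
Proof.
move=> h; have -> : w = 1 - x - y by rewrite -h; ring.
by rewrite /orient !coordE; ring.
Qed.

Lemma orient_comb2 (t : R) p q a b :
  orient p q ((1 - t) *: a + t *: b) = (1 - t) * orient p q a + t * orient p q b.
Proof. by rewrite /orient !coordE; ring. Qed.

Lemma orientaab a b : orient a a b = 0. Proof. by rewrite /orient; ring. Qed.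
Lemma orientaba a b : orient a b a = 0. Proof. by rewrite /orient; ring. Qed.
Lemma orientabb a b : orient a b b = 0. Proof. by rewrite /orient; ring. Qed.

Lemma line_param a b c : a != b -> orient a b c = 0 ->
  exists t : R, c = (1 - t) *: a + t *: b.
Proof.
rewrite /orient => ab h.
have [hx|hx] := eqVneq (px b - px a) 0; last first.
  exists ((px c - px a) / (px b - px a)); apply: pt_eq; rewrite !coordE; first by field.
  apply: (mulfI hx); rewrite -[LHS]subr0 -h; field; exact: hx.
have hy : py b - py a != 0.
  apply/eqP => hy; case/eqP: ab; apply: pt_eq; lra.
exists ((py c - py a) / (py b - py a)); apply: pt_eq; rewrite !coordE; last by field.
move: h; rewrite hx mul0r sub0r => /eqP; rewrite oppr_eq0 mulf_eq0 (negbTE hy) /= => /eqP h.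
have -> : px b = px a by lra.
rewrite -mulrDl subrK mul1r; lra.
Qed.


Lemma line_col p q x y z : p != q -> orient p q x = 0 -> orient p q y = 0 ->
  orient p q z = 0 -> orient x y z = 0.
Proof.
move=> pq /(line_param pq)[? ->] /(line_param pq)[? ->] /(line_param pq)[? ->].
by rewrite /orient !coordE; ring.
Qed.

Lemma tri_weights (x y w : R) a b c z :
  0 <= x -> 0 <= y -> 0 <= w -> 0 < x + y + w ->
  (x + y + w) *: z = x *: a + y *: b + w *: c -> tri a b c z.
Proof.
move=> hx hy hw hs e; exists (x / (x + y + w)), (y / (x + y + w)), (w / (x + y + w)).
have hs0 : x + y + w != 0 by rewrite gt_eqF.
split; try by apply: divr_ge0 => //; apply: ltW.
- by field.
- have -> : z = (x + y + w)^-1 *: ((x + y + w) *: z) by rewrite scalerA mulVf // scale1r.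
  by rewrite e !scalerDr !scalerA ![_^-1 * _]mulrC.
Qed.

Lemma seg_tri a b z : seg a b z -> tri a a b z.
Proof.
case=> t [t0 t1 ->]; exists 0, (1 - t), t; split=> //; [lra|lra|].
by rewrite scale0r add0r.
Qed.

Lemma tri_seg a b z : tri a a b z -> seg a b z.
Proof.
case=> x [y [w [x0 y0 w0 h ->]]]; exists w; split=> //; first by lra.
have -> : 1 - w = x + y.
  rewrite -h; ring.
by rewrite scalerDl.
Qed.

Lemma segl a b : seg a b a.
Proof. by exists 0; split; [exact: lexx|exact: ler01|ptring]. Qed.

Lemma segC a b z : seg a b z -> seg b a z.
Proof. by case=> t [t0 t1 ->]; exists (1 - t); split; [lra|lra|ptring]. Qed.

Lemma segr a b : seg a b b. Proof. exact/segC/segl. Qed.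

Lemma btwC a o b : btw a o b -> btw b o a.
Proof. by case=> t [t0 t1 ->]; exists (1 - t); split; [lra|lra|ptring]. Qed.

Lemma btw_seg a o b : btw a o b -> seg a b o.
Proof. by case=> t [t0 t1 ->]; exists t; split=> //; apply: ltW. Qed.

Lemma seg_cases a b z : seg a b z -> [\/ z = a, z = b | btw a z b].
Proof.
case=> t [t0 t1 ->].
have [->|h0] := eqVneq t 0; first by constructor 1; ptring.
have [->|h1] := eqVneq t 1; first by constructor 2; ptring.
by constructor 3; exists t; split=> //; rewrite lt_neqAle; [rewrite eq_sym h0|rewrite h1].
Qed.

Lemma seg_tri12 a b c z : seg a b z -> tri a b c z.
Proof.
case=> t [t0 t1 ->]; exists (1 - t), t, 0; split=> //; [lra|lra|].
by rewrite scale0r addr0.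
Qed.

Lemma triC a b c z : tri a b c z -> tri b a c z.
Proof.
by case=> x [y [w [x0 y0 w0 h ->]]]; exists y, x, w; split=> //; [lra|ptring].
Qed.

Lemma tri_rot a b c z : tri a b c z -> tri b c a z.
Proof.
by case=> x [y [w [x0 y0 w0 h ->]]]; exists y, w, x; split=> //; [lra|ptring].
Qed.

Lemma tri1 a b c : tri a b c a. Proof. exact/seg_tri12/segl. Qed.
Lemma tri2 a b c : tri a b c b. Proof. exact/seg_tri12/segr. Qed.
Lemma tri3 a b c : tri a b c c. Proof. exact: tri_rot (tri1 c a b). Qed.

Lemma tri_sub a b c p q r z :
  tri a b c p -> tri a b c q -> tri a b c r -> tri p q r z -> tri a b c z.
Proof.
case=> [x1 [y1 [w1 [? ? ? h1 ->]]]] [x2 [y2 [w2 [? ? ? h2 ->]]]].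
case=> [x3 [y3 [w3 [? ? ? h3 ->]]]] [x [y [w [? ? ? h ->]]]].
exists (x * x1 + y * x2 + w * x3), (x * y1 + y * y2 + w * y3), (x * w1 + y * w2 + w * w3).
split; try by rewrite !addr_ge0 // mulr_ge0.
- transitivity (x * (x1 + y1 + w1) + y * (x2 + y2 + w2) + w * (x3 + y3 + w3)); first by ring.
  by rewrite h1 h2 h3 !mulr1.
- ptring.
Qed.

Lemma col_seg a b c : orient a b c = 0 -> [\/ seg a b c, seg b c a | seg a c b].
Proof.
move=> h; have [->|ab] := eqVneq a b; first by constructor 2; exact: segl.
have [t e] := line_param ab h.
(* The position of [t] relative to 0 and 1 decides which point is in the middle; the witnesses
   [(1 - t)^-1] and [t^-1] solve the equation of [c] for [a] and for [b]. *)
have [t0|t0] := ltP t 0.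
  constructor 2; exists ((1 - t)^-1); split.
  - by rewrite invr_ge0; lra.
  - by rewrite invf_le1; lra.
  - by rewrite e; apply: pt_eq; rewrite !coordE; field; lra.
have [t1|t1] := leP t 1; first by constructor 1; exists t.
constructor 3; exists (t^-1); split.
- by rewrite invr_ge0.
- by rewrite invf_le1; lra.
- by rewrite e; apply: pt_eq; rewrite !coordE; field; lra.
Qed.

Lemma sum_ratio (x y : R) : 0 < x * y -> [/\ x + y != 0, 0 < y / (x + y) & y / (x + y) < 1].
Proof.
move=> h; have [x0|x0|x0] := ltrgt0P x; last by move: h; rewrite x0 mul0r ltxx.
  have y0 : 0 < y by rewrite -(pmulr_rgt0 _ x0).
  by split; [rewrite gt_eqF //; lra|apply: divr_gt0; lra|rewrite ltr_pdivrMr; lra].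
have y0 : y < 0 by rewrite -(nmulr_rgt0 _ x0).
by split; [rewrite lt_eqF //; lra|rewrite nmulr_lgt0 // invr_lt0; lra|rewrite ltr_ndivrMr; lra].
Qed.

(** An affine dependence is solved for the point whose weight has the sign opposite to the others.
    Multiplying by [w1] treats both signs of [w1] at once: the weights become [- (w1 * wi)], with
    positive sum [w1 * w1]. *)
Lemma tri_dep (w1 w2 w3 w4 : R) a b c d :
  w1 + w2 + w3 + w4 = 0 -> w1 *: a + w2 *: b + w3 *: c + w4 *: d = 0 ->
  w1 != 0 -> w1 * w2 <= 0 -> w1 * w3 <= 0 -> w1 * w4 <= 0 -> tri b c d a.
Proof.
move=> hs e w10 h2 h3 h4.
have h5 : 0 < w1 * w1 by rewrite -expr2 exprn_even_gt0.
apply: (@tri_weights (- (w1 * w2)) (- (w1 * w3)) (- (w1 * w4))); rewrite ?oppr_ge0 //.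
  have -> : - (w1 * w2) + - (w1 * w3) + - (w1 * w4) = w1 * w1 - w1 * (w1 + w2 + w3 + w4) by ring.
  by rewrite hs mulr0 subr0.
have -> : - (w1 * w2) + - (w1 * w3) + - (w1 * w4) = w1 * w1 - w1 * (w1 + w2 + w3 + w4) by ring.
rewrite hs mulr0 subr0 -[RHS]addr0 -[0](scaler0 _ w1) -e; ptring.
Qed.

(** When the signs split two against two, moving [b] and [d] to the other side of the dependence and
    normalising exhibits one point on both diagonals. *)
Lemma cross_dep (w1 w2 w3 w4 : R) a b c d :
  w1 + w2 + w3 + w4 = 0 -> w1 *: a + w2 *: b + w3 *: c + w4 *: d = 0 ->
  0 < w1 * w3 -> 0 < w2 * w4 -> orient a b c != 0 -> exists o, cross a b c d o.
Proof.
move=> hs e /sum_ratio[n13 p13 q13] /sum_ratio[n24 p24 q24] ho.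
exists ((1 - w3 / (w1 + w3)) *: a + (w3 / (w1 + w3)) *: c); split=> //.
  by exists (w3 / (w1 + w3)).
exists (w4 / (w2 + w4)); split=> //.
have mean (x y u v : R) : x + y != 0 ->
  (1 - y / (x + y)) * u + y / (x + y) * v = (x * u + y * v) / (x + y).
  by move=> h; field.
have hw : w2 + w4 = - (w1 + w3) by lra.
have ex : w1 * px a + w2 * px b + w3 * px c + w4 * px d = 0 by rewrite -[RHS]px0 -e !coordE.
have ey : w1 * py a + w2 * py b + w3 * py c + w4 * py d = 0 by rewrite -[RHS]py0 -e !coordE.
apply: pt_eq; rewrite !coordE !mean // hw invrN mulrN -mulNr; congr (_ / _); lra.
Qed.

Ltac mulsign :=
  first [by rewrite pmulr_rle0 // ltW | by rewrite nmulr_rle0 // ltW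
        | by rewrite pmulr_rgt0 | by rewrite nmulr_rgt0].

(** The signed areas of the four triples, with alternating signs, are the weights of an affine
    dependence. One sign against three gives a point in a triangle, two against two a crossing.
    Collinear triples are removed first: there one point lies on the segment of the other two. *)
Lemma radon a b c d :
  [\/ tri b c d a, tri a c d b, tri a b d c | tri a b c d] \/
  exists o, [\/ cross a b c d o, cross a c b d o | cross a b d c o].
Proof.
have sw x y z w : tri x y z w -> tri x z y w by move=> h; exact/triC/tri_rot/tri_rot/h.
have col x y z w : orient x y z = 0 -> [\/ tri y z w x, tri x z w y | tri x y w z].
  case/col_seg => h; [constructor 3|constructor 1|constructor 2]; exact: seg_tri12.
have [/(col _ _ _ d)[h|h|h]|nabc] := eqVneq (orient a b c) 0.
- by left; constructor 1.
- by left; constructor 2.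
- by left; constructor 3.
have [/(col _ _ _ c)[h|h|h]|nabd] := eqVneq (orient a b d) 0.
- by left; constructor 1; exact: sw.
- by left; constructor 2; exact: sw.
- by left; constructor 4.
have [/(col _ _ _ b)[h|h|h]|nacd] := eqVneq (orient a c d) 0.
- by left; constructor 1; do 2!apply: tri_rot.
- by left; constructor 3; exact: sw.
- by left; constructor 4; exact: sw.
have [/(col _ _ _ a)[h|h|h]|nbcd] := eqVneq (orient b c d) 0.
- by left; constructor 2; do 2!apply: tri_rot.
- by left; constructor 3; do 2!apply: tri_rot.
- by left; constructor 4; do 2!apply: tri_rot.
set w1 := orient b c d in nbcd *; pose w2 := - orient a c d.
set w3 := orient a b d in nabd *; pose w4 := - orient a b c.
have hs : w1 + w2 + w3 + w4 = 0 by rewrite /w1 /w2 /w3 /w4 /orient; ring.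
have e : w1 *: a + w2 *: b + w3 *: c + w4 *: d = 0.
  by apply: pt_eq; rewrite !coordE /w1 /w2 /w3 /w4 /orient; ring.
have n2 : w2 != 0 by rewrite oppr_eq0.
have n4 : w4 != 0 by rewrite oppr_eq0.
have nacb : orient a c b != 0 by rewrite orient_swap orient_rot oppr_eq0 orient_rot in nabc *.
have s12 : w2 + w1 + w3 + w4 = 0 by lra.
have s13 : w3 + w1 + w2 + w4 = 0 by lra.
have s14 : w4 + w1 + w2 + w3 = 0 by lra.
have e12 : w2 *: b + w1 *: a + w3 *: c + w4 *: d = 0 by rewrite -e; ptring.
have e13 : w3 *: c + w1 *: a + w2 *: b + w4 *: d = 0 by rewrite -e; ptring.
have e14 : w4 *: d + w1 *: a + w2 *: b + w3 *: c = 0 by rewrite -e; ptring.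
have c12 : w1 + w3 + w2 + w4 = 0 by lra.
have c14 : w1 + w2 + w4 + w3 = 0 by lra.
have f12 : w1 *: a + w3 *: c + w2 *: b + w4 *: d = 0 by rewrite -e; ptring.
have f14 : w1 *: a + w2 *: b + w4 *: d + w3 *: c = 0 by rewrite -e; ptring.
have C13 := cross_dep hs e. have C12 := cross_dep c12 f12. have C14 := cross_dep c14 f14.
have T1 := tri_dep hs e nbcd. have T2 := tri_dep s12 e12 n2.
have T3 := tri_dep s13 e13 nabd. have T4 := tri_dep s14 e14 n4.
have cr1 : 0 < w1 * w3 -> 0 < w2 * w4 -> exists o, [\/ cross a b c d o, cross a c b d o | cross a b d c o].
  by move=> h h'; have [o ?] := C13 h h' nabc; exists o; constructor 1.
have cr2 : 0 < w1 * w2 -> 0 < w3 * w4 -> exists o, [\/ cross a b c d o, cross a c b d o | cross a b d c o].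
  by move=> h h'; have [o ?] := C12 h h' nacb; exists o; constructor 2.
have cr3 : 0 < w1 * w4 -> 0 < w2 * w3 -> exists o, [\/ cross a b c d o, cross a c b d o | cross a b d c o].
  by move=> h h'; have [o ?] := C14 h h' nabd; exists o; constructor 3.
(* Sixteen sign patterns remain; the two with all signs equal contradict the vanishing sum [hs]. *)
clear - T1 T2 T3 T4 cr1 cr2 cr3 n2 n4 nbcd nabd hs.
case: (ltrgt0P w1) nbcd => // s1 _; case: (ltrgt0P w2) n2 => // s2 _;
  case: (ltrgt0P w3) nabd => // s3 _; case: (ltrgt0P w4) n4 => // s4 _; try (exfalso; clear - s1 s2 s3 s4 hs; lra).
all: try by left; constructor 1; apply: T1; mulsign.
all: try by left; constructor 2; apply: T2; mulsign.
all: try by left; constructor 3; apply: T3; mulsign.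
all: try by left; constructor 4; apply: T4; mulsign.
all: try by right; apply: cr1; mulsign.
all: try by right; apply: cr2; mulsign.
all: by right; apply: cr3; mulsign.
Qed.

Lemma cross_free_radon P a b c d : cross_free P -> P a -> P b -> P c -> P d ->
  [\/ tri b c d a, tri a c d b, tri a b d c | tri a b c d].
Proof.
move=> ncP Pa Pb Pc Pd; have [//|[o [x|x|x]]] := radon a b c d; exfalso.
- exact: (ncP _ _ _ _ _ Pa Pb Pc Pd x).
- exact: (ncP _ _ _ _ _ Pa Pc Pb Pd x).
- exact: (ncP _ _ _ _ _ Pa Pb Pd Pc x).
Qed.

End Radon.

(** * Convex hulls in the plane *)

Section Hull.
Context {R : realType}.
Implicit Types (a b c d o p q z : 'rV[R]_2) (A B P : set 'rV[R]_2).

Lemma convexP n (A : set 'rV[R]_n) : convex_set A <->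
  forall x y (t : R), A x -> A y -> 0 <= t -> t <= 1 -> A ((1 - t) *: x + t *: y).
Proof.
split=> [cA x y t Ax Ay t0 t1|cA x y l].
  have := cA y x (Itv01 t0 t1); rewrite !in_setE => /(_ Ay Ax).
  by rewrite addrC.
rewrite !in_setE => Ax Ay; have := cA y x l%:num Ay Ax (ge0 l) (le1 l).
  by rewrite addrC; apply.
Qed.

Lemma ch_convex n (A : set 'rV[R]_n) : convex_set (ch A).
Proof.
apply/convexP => x y t hx hy t0 t1 B [/= cB AB].
by move/convexP: (cB); apply => //; [exact: hx|exact: hy].
Qed.

Lemma sub_ch n (A : set 'rV[R]_n) : A `<=` ch A.
Proof. by move=> x Ax B [/= _]; exact. Qed.

Lemma ch_min n (A B : set 'rV[R]_n) : convex_set B -> A `<=` B -> ch A `<=` B.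
Proof. by move=> cB AB x; apply. Qed.

Lemma ch_mono n (A B : set 'rV[R]_n) : A `<=` B -> ch A `<=` ch B.
Proof. by move=> AB; apply: ch_min; [exact: ch_convex|move=> x /AB/sub_ch]. Qed.

Lemma ch_seg A a b : ch A a -> ch A b -> seg a b `<=` ch A.
Proof.
move=> ha hb z [t [t0 t1 ->]]; have /convexP := @ch_convex _ A; exact.
Qed.

Lemma ch_tri A a b c : ch A a -> ch A b -> ch A c -> tri a b c `<=` ch A.
Proof.
move=> ha hb hc z [x [y [w [x0 y0 w0 h ->]]]].
have [xy0|xy0] := eqVneq (x + y) 0.
  have [-> -> ->] : [/\ x = 0, y = 0 & w = 1] by split; lra.
  by rewrite !scale0r !add0r scale1r.
have xy : 0 < x + y by rewrite lt_neqAle eq_sym xy0 addr_ge0.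
apply: (@ch_seg A ((x / (x + y)) *: a + (y / (x + y)) *: b) c) => //.
  apply: (@ch_seg A a b) => //; exists (y / (x + y)); split.
  - exact: divr_ge0 (ltW xy).
  - by rewrite ler_pdivrMr // mul1r lerDr.
  - by congr (_ *: _ + _); field.
exists w; split=> //; first by lra.
have -> : 1 - w = x + y by lra.
by ptfield.
Qed.

(** Carathéodory's exchange: weight is shifted from [a] and [c] to [b] and [d] along the relation
    given by the crossing, until one of the first two vanishes. Comparing [w1 * s] with
    [w3 * (1 - s)] tells which vanishes first. *)
Lemma quad_diag (w1 w2 w3 w4 : R) a b c d z o : 0 <= w1 -> 0 <= w2 -> 0 <= w3 -> 0 <= w4 ->
  w1 + w2 + w3 + w4 = 1 -> z = w1 *: a + w2 *: b + w3 *: c + w4 *: d ->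
  cross a b c d o -> tri b c d z \/ tri a b d z.
Proof.
move=> h1 h2 h3 h4 hs ez [[s [s0 s1 es]] [t [t0 t1 et]] _].
have e : (1 - s) *: a + s *: c = (1 - t) *: b + t *: d by rewrite -es.
have ex : (1 - s) * px a + s * px c = (1 - t) * px b + t * px d by move: (congr1 (@px _) e); rewrite !coordE.
have ey : (1 - s) * py a + s * py c = (1 - t) * py b + t * py d by move: (congr1 (@py _) e); rewrite !coordE.
have [hh|hh] := leP (w1 * s) (w3 * (1 - s)).
- left; exists (w2 + w1 / (1 - s) * (1 - t)), (w3 - w1 / (1 - s) * s), (w4 + w1 / (1 - s) * t).
  have k0 : 0 <= w1 / (1 - s) by apply: divr_ge0 => //; lra.
  have n0 : 1 - s != 0 by rewrite gt_eqF //; lra.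
  split.
  + by rewrite addr_ge0 // mulr_ge0 //; lra.
  + by rewrite subr_ge0 mulrAC ler_pdivrMr //; lra.
  + by rewrite addr_ge0 // mulr_ge0 //; lra.
  + by rewrite -[RHS]hs; field.
  + rewrite ez; apply: pt_eq; rewrite !coordE.
    * transitivity (w1 / (1 - s) * ((1 - s) * px a + s * px c - s * px c) + w2 * px b + w3 * px c + w4 * px d); first by field.
      by rewrite ex; ring.
    * transitivity (w1 / (1 - s) * ((1 - s) * py a + s * py c - s * py c) + w2 * py b + w3 * py c + w4 * py d); first by field.
      by rewrite ey; ring.
- right; exists (w1 - w3 / s * (1 - s)), (w2 + w3 / s * (1 - t)), (w4 + w3 / s * t).
  have k0 : 0 <= w3 / s by apply: divr_ge0 => //; lra.
  have n0 : s != 0 by rewrite gt_eqF //; lra.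
  split.
  + by rewrite subr_ge0 mulrAC ler_pdivrMr //; lra.
  + by rewrite addr_ge0 // mulr_ge0 //; lra.
  + by rewrite addr_ge0 // mulr_ge0 //; lra.
  + by rewrite -[RHS]hs; field.
  + rewrite ez; apply: pt_eq; rewrite !coordE.
    * transitivity (w3 / s * ((1 - s) * px a + s * px c - (1 - s) * px a) + w1 * px a + w2 * px b + w4 * px d); first by field.
      by rewrite ex; ring.
    * transitivity (w3 / s * ((1 - s) * py a + s * py c - (1 - s) * py a) + w1 * py a + w2 * py b + w4 * py d); first by field.
      by rewrite ey; ring.
Qed.

Definition hull3 A : set 'rV[R]_2 :=
  [set z | exists a b c, [/\ A a, A b, A c & tri a b c z]].

(** Radon is applied to [b] and the vertices of a triangle around [z]. Either three of the four
    points span all of them, or they form a quadrilateral, which a diagonal cuts into two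
    triangles. *)
Lemma hull3_star A z b w : hull3 A z -> A b -> seg z b w -> hull3 A w.
Proof.
case=> [a1 [a2 [a3 [A1 A2 A3 tz]]]] Ab sw.
have [h|[o h]] := radon a1 a2 a3 b.
  have [c1 [c2 [c3 [C1 C2 C3 cz cb]]]] : exists c1 c2 c3,
      [/\ A c1, A c2, A c3, tri c1 c2 c3 z & tri c1 c2 c3 b].
    case: h => h.
    - exists a2, a3, b; split=> //; last exact: tri3.
      by apply: tri_sub tz => //; [exact: tri1|exact: tri2].
    - exists a1, a3, b; split=> //; last exact: tri3.
      by apply: tri_sub tz => //; [exact: tri1|exact: tri2].
    - exists a1, a2, b; split=> //; last exact: tri3.
      by apply: tri_sub tz => //; [exact: tri1|exact: tri2].
    - by exists a1, a2, a3.
  by exists c1, c2, c3; split=> //; apply: (tri_sub cz cz cb); exact: seg_tri.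
case: tz => [x [y [v [x0 y0 v0 hs ez]]]]; case: sw => t [t0 t1 ew].
have g1 : 0 <= (1 - t) * x by rewrite mulr_ge0 //; lra.
have g2 : 0 <= (1 - t) * y by rewrite mulr_ge0 //; lra.
have g3 : 0 <= (1 - t) * v by rewrite mulr_ge0 //; lra.
case: h => h.
- have E1 : (1 - t) * x + (1 - t) * y + (1 - t) * v + t = 1.
    by transitivity ((1 - t) * (x + y + v) + t); [ring|rewrite hs; ring].
  have E2 : w = ((1 - t) * x) *: a1 + ((1 - t) * y) *: a2 + ((1 - t) * v) *: a3 + t *: b.
    by rewrite ew ez; ptring.
  by have [k|k] := quad_diag g1 g2 g3 t0 E1 E2 h; [exists a2, a3, b|exists a1, a2, b].
- have E1 : (1 - t) * x + (1 - t) * v + (1 - t) * y + t = 1.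
    by transitivity ((1 - t) * (x + y + v) + t); [ring|rewrite hs; ring].
  have E2 : w = ((1 - t) * x) *: a1 + ((1 - t) * v) *: a3 + ((1 - t) * y) *: a2 + t *: b.
    by rewrite ew ez; ptring.
  by have [k|k] := quad_diag g1 g3 g2 t0 E1 E2 h; [exists a3, a2, b|exists a1, a3, b].
- have E1 : (1 - t) * x + (1 - t) * y + t + (1 - t) * v = 1.
    by transitivity ((1 - t) * (x + y + v) + t); [ring|rewrite hs; ring].
  have E2 : w = ((1 - t) * x) *: a1 + ((1 - t) * y) *: a2 + t *: b + ((1 - t) * v) *: a3.
    by rewrite ew ez; ptring.
  by have [k|k] := quad_diag g1 g2 t0 g3 E1 E2 h; [exists a2, b, a3|exists a1, a2, a3].
Qed.

(** A combination of [x] with a point of the triangle [b1 b2 b3] is reached from [x] by moving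
    towards [b1], then [b2], then [b3], and each move is an instance of [hull3_star]. The separate
    cases are those where a normalising factor vanishes and the start of a move has weight zero. *)
Lemma hull3_convex A : convex_set (hull3 A).
Proof.
apply/convexP => x z t hx [b1 [b2 [b3 [B1 B2 B3]]]].
case=> [u [v [w [u0 v0 w0 hs ->]]]] t0 t1.
have step c k (m : R) : hull3 A c -> A k -> 0 <= m -> m <= 1 -> hull3 A ((1 - m) *: c + m *: k).
  by move=> hc hk m0 m1; apply: (hull3_star hc hk); exists m.
have k3 := mulr_ge0 t0 w0; have k2 := mulr_ge0 t0 v0; have k1 := mulr_ge0 t0 u0.
have hst : t * u + t * v + t * w = t by rewrite -!mulrDr hs mulr1.
have [h|h] := eqVneq (1 - t * w) 0.
  have [e1 e2 [e3 e4]] : [/\ t * u = 0, t * v = 0 & t * w = 1 /\ t = 1] by split; [lra|lra|split;lra].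
  rewrite !scalerDr !scalerA e1 e2 e3 e4 subrr !scale0r !add0r scale1r.
  by exists b3, b3, b3; split=> //; exact: tri1.
have h' : 0 < 1 - t * w by rewrite lt_neqAle eq_sym h /=; lra.
have -> : (1 - t) *: x + t *: (u *: b1 + v *: b2 + w *: b3) =
    (1 - t * w) *: (((1 - t) / (1 - t * w)) *: x + (t * u / (1 - t * w)) *: b1
       + (t * v / (1 - t * w)) *: b2) + (t * w) *: b3 by ptfield.
apply: (step _ _ _) => //; last by lra.
have [k|k] := eqVneq (1 - t * w - t * v) 0.
  have [e1 e2] : t * u = 0 /\ 1 - t = 0 by split; lra.
  rewrite e1 e2 !mul0r !scale0r !add0r (_ : t * v / _ = 1) ?scale1r; last first.
    by rewrite (_ : t * v = 1 - t * w) ?divff //; lra.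
  by exists b2, b2, b2; split=> //; exact: tri1.
have k' : 0 < 1 - t * w - t * v by rewrite lt_neqAle eq_sym k /=; lra.
have -> : ((1 - t) / (1 - t * w)) *: x + (t * u / (1 - t * w)) *: b1
       + (t * v / (1 - t * w)) *: b2 =
   (1 - t * v / (1 - t * w)) *: ((1 - t * u / (1 - t * w - t * v)) *: x
      + (t * u / (1 - t * w - t * v)) *: b1) + (t * v / (1 - t * w)) *: b2.
  have et : 1 - t = 1 - t * u - t * v - t * w by lra.
  by rewrite et; apply: pt_eq; rewrite !coordE; field; rewrite h k.
apply: (step _ _ _) => //.
- apply: (step _ _ _) => //; first by apply: divr_ge0 => //; lra.
  by rewrite ler_pdivrMr //; lra.
- by apply: divr_ge0 => //; lra.
- by rewrite ler_pdivrMr //; lra.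
Qed.

(** Carathéodory's theorem in the plane. *)
Lemma chE A : ch A = hull3 A.
Proof.
rewrite eqEsubset; split.
  apply: ch_min; first exact: hull3_convex.
  by move=> x Ax; exists x, x, x; split=> //; exact: tri1.
by move=> z [a [b [c [Aa Ab Ac h]]]]; apply: ch_tri h; exact: sub_ch.
Qed.

End Hull.

(** * Meets of hulls *)

Section Meet.
Context {R : realType}.
Implicit Types (a b c d e o p q z : 'rV[R]_2) (A B P X : set 'rV[R]_2).

Lemma bary a b c z : orient a b c != 0 -> exists x y w : R,
  x + y + w = 1 /\ z = x *: a + y *: b + w *: c.
Proof.
move=> h; exists (orient b c z / orient a b c), (orient c a z / orient a b c), (orient a b z / orient a b c).
split.
  by rewrite -!mulrDl (_ : _ + _ + _ = orient a b c) ?divff // /orient; ring.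
by rewrite /orient in h *; apply: pt_eq; rewrite !coordE; field; exact: h.
Qed.

(** Applied to a barycentric coordinate along a segment: [t0] is the time up to which it stays
    nonnegative, cut off at 1. *)
Lemma exit_time (x y : R) : 0 <= x -> exists t0 : R,
  [/\ 0 <= t0, t0 <= 1, forall t, 0 <= t -> t <= t0 -> 0 <= (1 - t) * x + t * y &
      t0 = 1 \/ (1 - t0) * x + t0 * y = 0].
Proof.
move=> x0; have [y0|y0] := leP 0 y.
  exists 1; split; [exact: ler01|exact: lexx| |by left].
  by move=> t t0 t1; rewrite addr_ge0 // mulr_ge0 //; lra.
have xy : 0 < x - y by lra.
exists (x / (x - y)); split.
- by apply: divr_ge0 => //; exact: ltW.
- by rewrite ler_pdivrMr //; lra.
- by move=> t t0; rewrite ler_pdivlMr //; lra.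
- by right; field; rewrite gt_eqF.
Qed.

(** The barycentric coordinates in a triangle of [B]-points around [z] vary affinely towards [v];
    the first to vanish marks the exit through an edge. The walk leaves this triangle, possibly not
    [ch B], but an edge between points of [B] is all that is wanted. *)
Lemma hull_exit B z v : ch B z -> exists e, [/\ seg z v e, ch B e &
  e = v \/ exists b1 b2, [/\ B b1, B b2 & seg b1 b2 e]].
Proof.
move=> Bz; have := Bz; rewrite {1}chE => -[b1 [b2 [b3 [B1 B2 B3 tz]]]].
have [h|h] := eqVneq (orient b1 b2 b3) 0.
  exists z; split=> //; [exact: segl|right].
  have tt (x y w : 'rV[R]_2) : seg x y w -> tri x y w z -> seg x y z.
    move=> k tk; apply: tri_seg; apply: tri_sub tk; [exact: tri1|exact: tri3|exact: seg_tri].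
  case/col_seg: h => k.
  - by exists b1, b2; split=> //; exact: tt tz.
  - by exists b2, b3; split=> //; apply: tt k _; exact: tri_rot.
  - by exists b1, b3; split=> //; apply: tt k _; exact/triC/tri_rot/tri_rot.
have [y1 [y2 [y3 [hy ev]]]] := bary v h.
case: tz => x1 [x2 [x3 [x10 x20 x30 hx ez]]].
have [t1 [t10 t11 p1 q1]] := exit_time y1 x10.
have [t2 [t20 t21 p2 q2]] := exit_time y2 x20.
have [t3 [t30 t31 p3 q3]] := exit_time y3 x30.
pose t := Num.min t1 (Num.min t2 t3).
have tle : [/\ t <= t1, t <= t2 & t <= t3] by rewrite /t !ge_min !lexx /= !orbT.
have t0 : 0 <= t by rewrite /t !le_min t10 t20 t30.
have tq : t = t1 \/ t = t2 \/ t = t3.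
  rewrite /t; case: (leP t2 t3) => _.
    by case: (leP t1 t2) => _; auto.
  by case: (leP t1 t3) => _; auto.
case: tle => l1 l2 l3.
have ee : (1 - t) *: z + t *: v = ((1 - t) * x1 + t * y1) *: b1 +
   ((1 - t) * x2 + t * y2) *: b2 + ((1 - t) * x3 + t * y3) *: b3.
  by rewrite ez ev; ptring.
have es : (1 - t) * x1 + t * y1 + ((1 - t) * x2 + t * y2) + ((1 - t) * x3 + t * y3) = 1.
  transitivity ((1 - t) * (x1 + x2 + x3) + t * (y1 + y2 + y3)); first by ring.
  by rewrite hx hy; ring.
have te : tri b1 b2 b3 ((1 - t) *: z + t *: v).
  rewrite ee; exists ((1 - t) * x1 + t * y1), ((1 - t) * x2 + t * y2), ((1 - t) * x3 + t * y3).
  by split; [exact: p1|exact: p2|exact: p3|exact: es|].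
exists ((1 - t) *: z + t *: v); split.
- by exists t; split=> //; apply: le_trans l1 t11.
- by apply: ch_tri te; exact: sub_ch.
case: te => u1 [u2 [u3 [u10 u20 u30 hu eu]]].
have [E|T1] := eqVneq t 1; first by left; rewrite E subrr scale0r add0r scale1r.
right; move: (p1 t t0 l1) (p2 t t0 l2) (p3 t t0 l3) es ee.
set c1 := _ + t * y1; set c2 := _ + t * y2; set c3 := _ + t * y3.
move=> c10 c20 c30 es ->.
case: tq => [E|[E|E]].
- case: q1 => [F|F]; first by rewrite E F eqxx in T1.
  have c1E : c1 = 0 by rewrite /c1 E.
  exists b2, b3; split=> //; exists c3; split=> //; [lra|].
  by rewrite c1E scale0r add0r (_ : c2 = 1 - c3) //; lra.
- case: q2 => [F|F]; first by rewrite E F eqxx in T1.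
  have c2E : c2 = 0 by rewrite /c2 E.
  exists b1, b3; split=> //; exists c3; split=> //; [lra|].
  by rewrite c2E scale0r addr0 (_ : c1 = 1 - c3) //; lra.
- case: q3 => [F|F]; first by rewrite E F eqxx in T1.
  have c3E : c3 = 0 by rewrite /c3 E.
  exists b1, b2; split=> //; exists c2; split=> //; [lra|].
  by rewrite c3E scale0r addr0 (_ : c1 = 1 - c2) //; lra.
Qed.

Definition lineat p q (t : R) := (1 - t) *: p + t *: q.

Lemma seg_lineat p q (r s t : R) : r <= t -> t <= s ->
  seg (lineat p q r) (lineat p q s) (lineat p q t).
Proof.
move=> rt ts; have [e|ne] := eqVneq r s.
  have -> : t = r by lra.
  exact: segl.
have rs : 0 < s - r by rewrite subr_gt0 lt_neqAle ne; apply: le_trans ts.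
exists ((t - r) / (s - r)); split.
- by apply: divr_ge0; lra.
- by rewrite ler_pdivrMr //; lra.
- by rewrite /lineat; apply: pt_eq; rewrite !coordE; field; rewrite gt_eqF.
Qed.

Lemma lineat0 p q : lineat p q 0 = p. Proof. by rewrite /lineat; ptring. Qed.
Lemma lineat1 p q : lineat p q 1 = q. Proof. by rewrite /lineat; ptring. Qed.

(** Recovers [z] from the stops [e] and [f] of the two walks that start at [z] in opposite
    directions. *)
Lemma seg_between p q z e f : seg p q z -> seg z p e -> seg z q f -> seg e f z.
Proof.
case=> t [t0 t1 ->] [s [s0 s1 ->]] [r [r0 r1 ->]].
have -> : (1 - s) *: ((1 - t) *: p + t *: q) + s *: p = lineat p q ((1 - s) * t).
  by rewrite /lineat; ptring.
have -> : (1 - r) *: ((1 - t) *: p + t *: q) + r *: q = lineat p q (t + r * (1 - t)).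
  by rewrite /lineat; ptring.
apply: seg_lineat; last by rewrite lerDl mulr_ge0 //; lra.
by rewrite ler_piMl //; lra.
Qed.

Lemma seg_sub p q a b z : seg p q a -> seg p q b -> seg a b z -> seg p q z.
Proof.
move=> ha hb hz; apply: tri_seg; apply: tri_sub (seg_tri hz); exact: seg_tri.
Qed.

(** Two overlapping segments of one line meet in a segment whose ends are ends of the given ones,
    hence in [P]: the larger of 0 and [r], and the smaller of 1 and [s]. *)
Lemma seg_meet_lineat P p q (r s t : R) :
  P p -> P q -> P (lineat p q r) -> P (lineat p q s) ->
  0 <= t -> t <= 1 -> r <= t -> t <= s ->
  ch (seg p q `&` seg (lineat p q r) (lineat p q s) `&` P) (lineat p q t).
Proof.
move=> Pp Pq Pr Ps t0 t1 rt ts; set M := ch _.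
have [l [lt Ml]] : exists l, l <= t /\ M (lineat p q l).
  have [r0|r0] := leP 0 r.
    exists r; split=> //; apply: sub_ch; split=> //; split; last exact: segl.
    rewrite -{1}(lineat0 p q) -{2}(lineat1 p q); apply: seg_lineat => //.
    exact: le_trans rt t1.
  exists 0; split=> //; apply: sub_ch; rewrite lineat0; split=> //; split; first exact: segl.
  by rewrite -{3}(lineat0 p q); apply: seg_lineat; [exact: ltW|exact: le_trans ts].
have [u [tu Mu]] : exists u, t <= u /\ M (lineat p q u).
  have [s1|s1] := leP s 1.
    exists s; split=> //; apply: sub_ch; split=> //; split; last exact: segr.
    rewrite -{1}(lineat0 p q) -{2}(lineat1 p q); apply: seg_lineat => //.
    exact: le_trans t0 ts.
  exists 1; split=> //; apply: sub_ch; rewrite lineat1; split=> //; split; first exact: segr.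
  by rewrite -{3}(lineat1 p q); apply: seg_lineat; [exact: le_trans t1|exact: ltW].
exact: (ch_seg Ml Mu (seg_lineat _ _ lt tu)).
Qed.

(** A common point is an end of one segment, a proper crossing (in [P] by closedness), or part of an
    overlap of collinear segments. *)
Lemma seg_meet P p q a b z : cross_closed P -> P p -> P q -> P a -> P b ->
  seg p q z -> seg a b z -> ch (seg p q `&` seg a b `&` P) z.
Proof.
move=> ccP Pp Pq Pa Pb zpq zab.
have inP : P z -> ch (seg p q `&` seg a b `&` P) z by move=> Pz; exact: sub_ch.
have [e|e|bpq] := seg_cases zpq; [by apply: inP; rewrite e|by apply: inP; rewrite e|].
have [e|e|bab] := seg_cases zab; [by apply: inP; rewrite e|by apply: inP; rewrite e|].
have [h|h] := eqVneq (orient p a q) 0; last by apply: inP; exact: (ccP p a q b).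
have [epq|npq] := eqVneq p q.
  apply: inP; case: zpq => t [_ _ ->].
  by have -> : (1 - t) *: p + t *: q = p by rewrite epq; ptring.
have h' : orient p q a = 0 by rewrite orient_rot orient_swap -orient_rot h oppr0.
have [r ea] := line_param npq h'.
case: bpq => t [t0 t1 ez]; case: (bab) => s [s0 s1 ez'].
have [u eb] : exists u, b = lineat p q u.
  exists ((t - (1 - s) * r) / s).
  have n0 : s != 0 by rewrite gt_eqF.
  have -> : b = s^-1 *: (z - (1 - s) *: a).
    by rewrite ez' addrC addKr scalerA mulVf // scale1r.
  by rewrite ez ea /lineat; apply: pt_eq; rewrite !coordE; field.
(* Read off in a coordinate where [p] and [q] differ. *)
have tE : t = (1 - s) * r + s * u.
  have [w [nw hw]] : exists w : R, w != 0 /\ (t - ((1 - s) * r + s * u)) * w = 0.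
    have ex := congr1 (@px R) ez; have ey := congr1 (@py R) ez.
    move: ex ey; rewrite ez' ea eb /lineat !coordE => ex ey.
    have [k|k] := eqVneq (px q - px p) 0.
      exists (py q - py p); split; last by lra.
      by apply: contra npq => /eqP k'; apply/eqP; apply: pt_eq; lra.
    by exists (px q - px p); split=> //; lra.
  by move/eqP: hw; rewrite mulf_eq0 (negbTE nw) orbF subr_eq0 => /eqP.
rewrite -/(lineat p q r) in ea; rewrite -/(lineat p q t) in ez.
rewrite ez; have [ru|ru] := leP r u.
  have k1 : 0 <= s * (u - r) by rewrite mulr_ge0 ?subr_ge0 // ltW.
  have k2 : 0 <= (1 - s) * (u - r) by rewrite mulr_ge0 ?subr_ge0 // ltW.
  by rewrite ea eb; apply: seg_meet_lineat; rewrite -?ea -?eb //; [exact: ltW|exact: ltW|lra|lra].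
have k1 : 0 <= s * (r - u) by rewrite mulr_ge0 ?subr_ge0 // ltW.
have k2 : 0 <= (1 - s) * (r - u) by rewrite mulr_ge0 ?subr_ge0 // ltW.
have -> : seg a b = seg b a by rewrite eqEsubset; split=> y; exact: segC.
by rewrite ea eb; apply: seg_meet_lineat; rewrite -?ea -?eb //; [exact: ltW|exact: ltW|lra|lra].
Qed.

(** From [z] one walks inside [ch B] towards [p] and towards [q]. Each walk ends at [p] or [q]
    itself, or on a segment between points of [B], where [seg_meet] applies. *)
Lemma seg_hull_meet P A B p q z : cross_closed P -> B `<=` P -> P p -> P q ->
  seg p q `<=` ch A -> seg p q z -> ch B z -> ch (ch A `&` ch B `&` P) z.
Proof.
move=> ccP BP Pp Pq pqA zpq Bz; set M := ch _.
have half v : (v = p \/ v = q) -> exists e, seg z v e /\ M e.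
  move=> hv; have vpq : seg p q v by case: hv => ->; [exact: segl|exact: segr].
  have [e [ze Be h]] := hull_exit v Bz; exists e; split=> //.
  case: h => [ev|[b1 [b2 [B1 B2 eb]]]].
    by apply: sub_ch; split; [split=> //; apply: pqA; rewrite ev|rewrite ev; case: hv => ->].
  have epq : seg p q e by exact: seg_sub zpq vpq ze.
  apply: ch_mono (seg_meet ccP Pp Pq (BP _ B1) (BP _ B2) epq eb).
  move=> x [[xpq xb] Px]; split=> //; split; first exact: pqA.
  by apply: ch_seg xb; exact: sub_ch.
have [e [ze Me]] := half p (or_introl erefl).
have [f [zf Mf]] := half q (or_intror erefl).
exact: (ch_seg Me Mf (seg_between zpq ze zf)).
Qed.

(* A point of the meet lies between a vertex of a triangle in ch A and a point
   of the opposite edge; walking towards either one stops there or at an edge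
   of ch B, which reduces the claim to the case where A spans a segment. *)
Lemma hull_meet P A B : cross_closed P -> A `<=` P -> B `<=` P ->
  ch A `&` ch B = ch (ch A `&` ch B `&` P).
Proof.
move=> ccP AP BP; rewrite eqEsubset; split; last first.
  apply: ch_min; last by move=> x [].
  apply/convexP => x y t [xA xB] [yA yB] t0 t1.
  by split; [apply: (ch_seg xA yA)|apply: (ch_seg xB yB)]; exists t.
move=> z [zA zB]; set M := ch _; have := zA.
rewrite {1}chE => -[a1 [a2 [a3 [A1 A2 A3 [x [y [w [x0 y0 w0 h ez]]]]]]]].
have [yw|yw] := eqVneq (y + w) 0.
  have ea : z = a1.
    have e0 : x = 1 by lra.
    have e1 : y = 0 by lra.
    have e2 : w = 0 by lra.
    by rewrite ez e0 e1 e2 scale1r !scale0r !addr0.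
  by apply: sub_ch; split=> //; rewrite ea; exact: AP.
have yw0 : 0 < y + w by rewrite lt_neqAle eq_sym yw addr_ge0.
pose v := (1 - w / (y + w)) *: a2 + (w / (y + w)) *: a3.
have v23 : seg a2 a3 v.
  exists (w / (y + w)); split=> //; first by exact: divr_ge0 (ltW yw0).
  by rewrite ler_pdivrMr // mul1r lerDr.
have zv : seg a1 v z.
  exists (1 - x); split; [lra|lra|].
  have -> : x = 1 - (y + w) by lra.
  by rewrite /v ez (_ : x = 1 - (y + w)); [apply: pt_eq; rewrite !coordE; field|lra].
have edge e b1 b2 : B b1 -> B b2 -> seg b1 b2 e -> ch A e -> M e.
  move=> B1 B2 eb Ae; rewrite /M (setIC (ch A)).
  apply: (seg_hull_meet ccP AP (BP _ B1) (BP _ B2) _ eb Ae).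
  by apply: ch_seg; exact: sub_ch.
have vA : ch A v by apply: ch_seg v23; exact: sub_ch.
have half u : u = a1 \/ u = v -> exists e, seg z u e /\ M e.
  move=> hu; have uA : ch A u by case: hu => -> //; exact: sub_ch.
  have [e [ze Be h']] := hull_exit u zB; exists e; split=> //.
  have eA : ch A e by exact: ch_seg ze.
  case: h' => [eu|[b1 [b2 [B1 B2 eb]]]]; last exact: edge eb eA.
  case: hu => hu.
    by apply: sub_ch; split; [split|rewrite eu hu; exact: AP].
  apply: (seg_hull_meet ccP BP (AP _ A2) (AP _ A3) _ _ Be); last by rewrite eu hu.
  by apply: ch_seg; exact: sub_ch.
have [e [ze Me]] := half a1 (or_introl erefl).
have [f [zf Mf]] := half v (or_intror erefl).
exact: (ch_seg Me Mf (seg_between zv ze zf)).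
Qed.

Lemma finite_powerset (T : choiceType) (A : set T) : finite_set A ->
  finite_set [set B | B `<=` A].
Proof.
case/finite_seqP => s ->; case: s => [|x0 s'].
  apply: (@sub_finite_set _ _ [set set0]); last exact: finite_set1.
  by move=> B /= hB; rewrite eqEsubset; split=> // x /hB.
set s := x0 :: s'.
pose F (m : {set 'I_(size s)}) := [set x | exists i, i \in m /\ x = nth x0 s i].
apply: (@sub_finite_set _ _ (F @` setT)); last exact/finite_image/finite_finset.
move=> B /= hB; exists [set i : 'I_(size s) | nth x0 s i \in B]%SET => //.
rewrite eqEsubset; split=> [x [i []]|x Bx].
  by rewrite inE in_setE => h ->.
have xs : (index x s < size s)%N by rewrite index_mem; exact: hB.
exists (Ordinal xs); have e : nth x0 s (index x s) = x by rewrite nth_index //; exact: hB.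
by split; rewrite /= ?e // inE in_setE /= e.
Qed.

Lemma finite_convex_lattice P X : finite_set P -> cross_closed P -> X `<=` P ->
  finite_set (convex_lattice X).
Proof.
move=> finP ccP XP.
apply: (@sub_finite_set _ _ ((@ch R 2) @` [set B | B `<=` P])); last exact/finite_image/finite_powerset.
move=> C; apply; split; last first.
  move=> _ [x Xx <-]; exists [set x]; first by move=> _ ->; exact: XP.
  rewrite eqEsubset; split; last exact: sub_ch.
  apply: ch_min => //; apply/convexP => u v t -> -> _ _ /=.
  by ptring.
split.
- by move=> _ [B _ <-]; exact: ch_convex.
- move=> _ _ [A AP <-] [B BP <-]; exists (A `|` B); first by move=> x [/AP|/BP].
  rewrite eqEsubset; split; apply: ch_min; try exact: ch_convex.
    by move=> x [] h; apply: sub_ch; [left|right]; exact: sub_ch.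
  by move=> x []; apply: ch_mono => y h; [left|right].
- move=> _ _ [A AP <-] [B BP <-]; exists (ch A `&` ch B `&` P); first by move=> x [].
  exact: esym (hull_meet ccP AP BP).
Qed.

Lemma convex_lattice_sublattice X : convex_sublattice (convex_lattice X).
Proof.
split.
(* [smallest] is an intersection, so convexity of its members needs one competitor: the family of
   all convex sets. *)
- have allc : [set M | convex_sublattice M /\ [set [set x] | x in X] `<=` M] (@convex_set R 'rV[R]_2).
    split; last first.
      move=> _ [x _ <-]; apply/convexP => u v t -> -> _ _ /=; by ptring.
    split=> // [A B _ _|A B /convexP cA /convexP cB]; first exact: ch_convex.
    by apply/convexP => x y t [? ?] [? ?] ? ?; split; [exact: cA|exact: cB].
  by move=> A /(_ _ allc).
- by move=> A B hA hB M hM; case: (hM) => -[_ h _] _; apply: h; [exact: hA|exact: hB].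
- by move=> A B hA hB M hM; case: (hM) => -[_ _ h] _; apply: h; [exact: hA|exact: hB].
Qed.

Lemma convex_lattice1 X x : X x -> convex_lattice X [set x].
Proof. by move=> Xx M [_]; apply; exists x. Qed.

(* P consists of the points whose singletons lie in the lattice: a proper
   crossing is the meet of two joins of singletons. *)
Lemma finite_lattice_closure X : finite_set (convex_lattice X) ->
  exists P, [/\ finite_set P, cross_closed P & X `<=` P].
Proof.
move=> finX; exists [set x | convex_lattice X [set x]]; split; last exact: convex_lattice1.
  apply: finite_preimage finX; move=> x y _ _ e.
  by have : [set x] x by []; rewrite e.
have [_ hj hm] := convex_lattice_sublattice X.
move=> a b c d o /= Pa Pb Pc Pd [ac bd nc].
suff -> : [set o] = ch ([set a] `|` [set c]) `&` ch ([set b] `|` [set d]) by apply: hm; apply: hj.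
have segE (u v : 'rV[R]_2) : ch ([set u] `|` [set v]) = seg u v.
  rewrite eqEsubset; split; last by apply: ch_seg; apply: sub_ch; [left|right].
  apply: ch_min; last by move=> x [] ->; [exact: segl|exact: segr].
  by apply/convexP => x y t hx hy t0 t1; apply: (@seg_sub u v x y) => //; exists t.
rewrite !segE eqEsubset; split; first by move=> _ ->; split; exact: btw_seg.
move=> z [[s [s0 s1 zs]] [t [t0 t1 zt]]] /=.
case: ac => s' [s0' s1' os]; case: bd => t' [t0' t1' ot].
(* Both points are zeros on [bd] of the affine function [orient a c], which is not constant there
   because it is nonzero at [b]; so their parameters agree. *)
have hz := congr1 (orient a c) zt; have ho := congr1 (orient a c) ot.
rewrite zs orient_comb2 orient_comb2 orientaba orientabb in hz.
rewrite os orient_comb2 orient_comb2 orientaba orientabb in ho.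
have nb : orient a c b != 0 by rewrite orient_rot orient_swap -orient_rot oppr_eq0.
have tt : t = t'.
  have /eqP : (t - t') * (orient a c d - orient a c b) = 0 by lra.
  rewrite mulf_eq0 subr_eq0 => /orP[/eqP//|/eqP h].
  have h' : orient a c d = orient a c b by lra.
  by case/eqP: nb; rewrite h' in hz; lra.
by rewrite zt tt ot.
Qed.

End Meet.

(** * Crossings *)

Section Crossing.
Context {R : realType}.
Implicit Types (a b c d e o p q z u v : 'rV[R]_2) (A B P X : set 'rV[R]_2).

Lemma finite_min (A : set R) x : finite_set A -> A x ->
  exists m, A m /\ forall y, A y -> m <= y.
Proof.
case/finite_seqP => s ->; elim: s x => // y s ih x _.
case: s ih => [|w s] ih.
  by exists y; split=> [|z]; rewrite /= !inE // => /eqP->.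
have [m [ms hm]] := ih w (mem_head _ _).
have [ym|ym] := leP y m.
  exists y; split=> [|z]; rewrite /= inE ?eqxx // => /orP[/eqP->//|/hm]; exact: le_trans.
exists m; split=> [|z]; first by rewrite /= inE [X in _ || X]ms orbT.
by rewrite /= inE => /orP[/eqP->|/hm//]; exact: ltW.
Qed.

(* The nonempty thin sets are exactly the configurations L_n, T_n, D_{p,q} and
   I_{p,q}. *)
Definition thin X : Prop := finite_set X /\ exists p q s s',
  [/\ 0 < orient p q s, orient p q s' < 0 &
      forall x, X x -> [\/ orient p q x = 0, x = s | x = s']].

Lemma thinI X p q s s' : finite_set X -> orient p q s * orient p q s' < 0 ->
  (forall x, X x -> [\/ orient p q x = 0, x = s | x = s']) -> thin X.
Proof.
move=> finX h hX; split=> //.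
have [h1|h1|h1] := ltrgt0P (orient p q s); last by move: h; rewrite h1 mul0r ltxx.
  by exists p, q, s, s'; split=> //; rewrite -(pmulr_rlt0 _ h1).
exists p, q, s', s; split=> //; first by rewrite -(nmulr_rlt0 _ h1).
by move=> x /hX[]; [constructor 1|constructor 3|constructor 2].
Qed.

Lemma thin_sub X Y : X `<=` Y -> thin Y -> thin X.
Proof.
move=> XY [finY [p [q [s [s' [hs hs' hY]]]]]]; split; first exact: sub_finite_set finY.
by exists p, q, s, s'; split=> // x /XY/hY.
Qed.

(** Coordinates with origin [o] and basis [u], [v]. With [o] a crossing and [u], [v] along the
    diagonals, the diagonals become the axes. *)
Definition affine_pt o u v (x y : R) := o + x *: u + y *: v.

Definition det2 u v : R := px u * py v - py u * px v.

Lemma orient_affine o u v (x1 y1 x2 y2 x3 y3 : R) :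
  orient (affine_pt o u v x1 y1) (affine_pt o u v x2 y2) (affine_pt o u v x3 y3) =
  det2 u v * ((x2 - x1) * (y3 - y1) - (y2 - y1) * (x3 - x1)).
Proof. by rewrite /orient /affine_pt /det2 !coordE; ring. Qed.

Lemma btw_affine o u v (x1 y1 x2 y2 x y t : R) : 0 < t -> t < 1 ->
  x = (1 - t) * x1 + t * x2 -> y = (1 - t) * y1 + t * y2 ->
  btw (affine_pt o u v x1 y1) (affine_pt o u v x y) (affine_pt o u v x2 y2).
Proof.
move=> t0 t1 -> ->; exists t; split=> //; rewrite /affine_pt; ptring.
Qed.

Lemma affine_inj o u v (x y x' y' : R) : det2 u v != 0 ->
  affine_pt o u v x y = affine_pt o u v x' y' -> x = x' /\ y = y'.
Proof.
move=> nD e; have ex := congr1 (@px R) e; have ey := congr1 (@py R) e.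
rewrite /affine_pt !coordE in ex ey.
have h1 : (x - x') * px u + (y - y') * px v = 0 by lra.
have h2 : (x - x') * py u + (y - y') * py v = 0 by lra.
have k1 : (x - x') * det2 u v = 0.
  transitivity (((x - x') * px u + (y - y') * px v) * py v - ((x - x') * py u + (y - y') * py v) * px v).
    by rewrite /det2; ring.
  by rewrite h1 h2 !mul0r subrr.
have k2 : (y - y') * det2 u v = 0.
  transitivity (((x - x') * py u + (y - y') * py v) * px u - ((x - x') * px u + (y - y') * px v) * py u).
    by rewrite /det2; ring.
  by rewrite h1 h2 !mul0r subrr.
move/eqP: k1; move/eqP: k2; rewrite !mulf_eq0 (negbTE nD) !orbF !subr_eq0.
by move=> /eqP-> /eqP->.
Qed.

Lemma affineP o u v z : det2 u v != 0 -> exists x y, z = affine_pt o u v x y.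
Proof.
move=> nD; exists (det2 (z - o) v / det2 u v), (det2 u (z - o) / det2 u v).
by rewrite /det2 in nD *; rewrite /affine_pt; apply: pt_eq; rewrite !coordE; field; exact: nD.
Qed.

(* Let a be the point of P nearest to o on the ray of u.  A point of P in the
   cone yields one in the triangle o, a, b with b on the ray of v, and its
   segment to the point beyond o meets the ray of u even nearer to o. *)
Lemma crossing_cone P o u v (s t k m x y : R) : finite_set P -> cross_closed P ->
  det2 u v != 0 -> 0 < s -> 0 < t -> 0 < k -> 0 < m -> 0 < x -> 0 < y ->
  P (affine_pt o u v s 0) -> P (affine_pt o u v (- k) 0) ->
  P (affine_pt o u v 0 t) -> P (affine_pt o u v 0 (- m)) ->
  ~ P (affine_pt o u v x y).
Proof.
move=> finP ccP nD s0' t0 k0 m0 x0 y0 Ps' Pk Pt Pm Pxy.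
have [a [[a0 Pa] amin]] : exists a : R, (0 < a /\ P (affine_pt o u v a 0)) /\
    forall b : R, 0 < b /\ P (affine_pt o u v b 0) -> a <= b.
  apply: (@finite_min [set r | 0 < r /\ P (affine_pt o u v r 0)] s) => //.
  apply: (@sub_finite_set _ _ ((fun r => affine_pt o u v r 0) @^-1` P)); first by move=> r [].
  by apply: finite_preimage finP => r r' _ _ /(affine_inj nD)[].
have Po : P (affine_pt o u v 0 0).
  apply: (ccP _ _ _ _ _ Pa Pt Pk Pm); split.
  - apply: (@btw_affine _ _ _ _ _ _ _ _ _ (a / (a + k))); [by apply: divr_gt0; lra| |by field; lra|by ring].
    by rewrite ltr_pdivrMr; lra.
  - apply: (@btw_affine _ _ _ _ _ _ _ _ _ (t / (t + m))); [by apply: divr_gt0; lra| |by ring|by field; lra].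
    by rewrite ltr_pdivrMr; lra.
  - rewrite orient_affine mulf_neq0 //.
    have -> : (0 - a) * (0 - 0) - (t - 0) * (- k - a) = t * (k + a) by ring.
    by rewrite mulf_neq0 // gt_eqF //; lra.
have [x' [y' [x'0 y'0 x'a Pxy']]] : exists x' y' : R, [/\ 0 < x', 0 < y', x' < a & P (affine_pt o u v x' y')].
  have at0 : 0 < a * t by rewrite mulr_gt0.
  have yt0 : 0 < y * a by rewrite mulr_gt0.
  have xt0 : 0 < x * t by rewrite mulr_gt0.
  pose w := x * t + y * a.
  have w0 : 0 < w by rewrite addr_gt0.
  have [h|h] := leP w (a * t).
    exists x, y; split=> //; rewrite -(ltr_pM2r t0); rewrite /w in h; lra.
  (* The given point lies beyond the segment from [(a, 0)] to [(0, t)]; it is replaced by the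
     crossing of that segment with its own segment to [o]. *)
  exists (a * t / w * x), (a * t / w * y).
  have q0 : 0 < a * t / w by rewrite divr_gt0.
  split; [by rewrite mulr_gt0|by rewrite mulr_gt0| |].
    by rewrite mulrAC ltr_pdivrMr // mulrAC -mulrA ltr_pM2l // /w; lra.
  apply: (ccP _ _ _ _ _ Po Pa Pxy Pt); split.
  - apply: (@btw_affine _ _ _ _ _ _ _ _ _ (a * t / w)) => //; [|by ring|by ring].
    by rewrite ltr_pdivrMr // mul1r.
  - apply: (@btw_affine _ _ _ _ _ _ _ _ _ (y * a / w)); [by rewrite divr_gt0| | |].
    + by rewrite ltr_pdivrMr // mul1r /w; lra.
    + by rewrite /w; field; rewrite gt_eqF.
    + by field; rewrite gt_eqF.
  - by rewrite orient_affine mulf_neq0 // !subr0 mul0r subr0 mulf_neq0 // gt_eqF.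
(* The abscissa at which the segment from [(x', y')] to [(0, - m)] meets the axis of [u]. *)
pose r := x' * m / (y' + m).
have r0 : 0 < r by apply: divr_gt0; [rewrite mulr_gt0|lra].
have ra : r < a.
  apply: le_lt_trans x'a; rewrite /r -mulrA ler_piMr ?(ltW x'0) //.
  by rewrite ler_pdivrMr; lra.
suff : a <= r by lra.
apply: amin; split=> //.
apply: (ccP _ _ _ _ _ Pa Pxy' Pk Pm); split.
- apply: (@btw_affine _ _ _ _ _ _ _ _ _ ((a - r) / (a + k))); [by apply: divr_gt0; lra| |by field; lra|by ring].
  by rewrite ltr_pdivrMr; lra.
- apply: (@btw_affine _ _ _ _ _ _ _ _ _ (y' / (y' + m))); [by apply: divr_gt0; lra| | |by field; lra].
    by rewrite ltr_pdivrMr; lra.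
  by rewrite /r; field; lra.
- rewrite orient_affine mulf_neq0 //.
  have -> : (x' - a) * (0 - 0) - (y' - 0) * (- k - a) = y' * (k + a) by ring.
  by rewrite mulf_neq0 // gt_eqF //; lra.
Qed.

(** Reversing [u] or [v] carries every quadrant to the positive one, the only one treated in
    [crossing_cone]. *)
Lemma affine_sign o u v (e f x y : R) :
  affine_pt o (e *: u) (f *: v) x y = affine_pt o u v (e * x) (f * y).
Proof. by rewrite /affine_pt !scalerA [x * e]mulrC [y * f]mulrC. Qed.

(** The segments from [(x1, 0)] to [(0, y2)] and from [(x2, 0)] to [(0, y1)] cross inside the
    positive quadrant, which [crossing_cone] forbids. *)
Lemma crossing_two_rays P o u v (x1 x2 k y1 y2 m : R) : finite_set P -> cross_closed P ->
  det2 u v != 0 -> 0 < x1 -> x1 < x2 -> 0 < k -> 0 < y1 -> y1 < y2 -> 0 < m ->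
  P (affine_pt o u v x1 0) -> P (affine_pt o u v x2 0) -> P (affine_pt o u v (- k) 0) ->
  P (affine_pt o u v 0 y1) -> P (affine_pt o u v 0 y2) -> P (affine_pt o u v 0 (- m)) ->
  False.
Proof.
move=> finP ccP nD x10 x12 k0 y10 y12 m0 Px1 Px2 Pk Py1 Py2 Pm.
have x20 : 0 < x2 by lra.
have y20 : 0 < y2 by lra.
have g1 : 0 < x1 * (y2 - y1) by rewrite mulr_gt0 // subr_gt0.
have g2 : 0 < y2 * (x2 - x1) by rewrite mulr_gt0 // subr_gt0.
have g3 : 0 < y1 * (x2 - x1) by rewrite mulr_gt0 // subr_gt0.
have g4 : 0 < x2 * (y2 - y1) by rewrite mulr_gt0 // subr_gt0.
pose w := x2 * y2 - x1 * y1.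
have w0 : 0 < w by rewrite /w; lra.
have P1 : 0 < y1 * (x2 - x1) / w by exact: divr_gt0.
have P2 : 0 < x1 * (y2 - y1) / w by exact: divr_gt0.
apply: (crossing_cone (x := x2 * (x1 * (y2 - y1) / w)) (y := y2 * (y1 * (x2 - x1) / w))
   finP ccP nD x10 y10 k0 m0 _ _ Px1 Pk Py1 Pm); [by rewrite mulr_gt0|by rewrite mulr_gt0|].
apply: (ccP _ _ _ _ _ Px1 Px2 Py2 Py1); split.
- apply: (@btw_affine _ _ _ _ _ _ _ _ _ (y1 * (x2 - x1) / w)) => //.
  + by rewrite ltr_pdivrMr // mul1r /w; lra.
  + by rewrite /w; field; rewrite gt_eqF.
  + by ring.
- apply: (@btw_affine _ _ _ _ _ _ _ _ _ (y2 * (x2 - x1) / w)).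
  + exact: divr_gt0.
  + by rewrite ltr_pdivrMr // mul1r /w; lra.
  + by rewrite /w; field; rewrite gt_eqF.
  + by rewrite mulr0 add0r /w; field; rewrite gt_eqF.
- rewrite orient_affine mulf_neq0 //.
  have -> : (x2 - x1) * (y2 - 0) - (0 - 0) * (0 - x1) = (x2 - x1) * y2 by ring.
  by rewrite mulf_neq0 // gt_eqF // subr_gt0.
Qed.

Lemma cross_thin P a b c d o : finite_set P -> cross_closed P ->
  P a -> P b -> P c -> P d -> cross a b c d o -> thin P.
Proof.
move=> finP ccP Pa Pb Pc Pd [[s [s0 s1 es]] [t [t0 t1 et]] nabc].
pose u := a - o; pose v := b - o; pose k := (1 - s) / s; pose m := (1 - t) / t.
have k0 : 0 < k by apply: divr_gt0; lra.
have m0 : 0 < m by apply: divr_gt0; lra.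
have sn : s != 0 by rewrite gt_eqF.
have tn : t != 0 by rewrite gt_eqF.
have ea : a = affine_pt o u v 1 0 by rewrite /affine_pt /u; ptring.
have eb : b = affine_pt o u v 0 1 by rewrite /affine_pt /v; ptring.
have ec : c = affine_pt o u v (- k) 0.
  have -> : c = s^-1 *: (o - (1 - s) *: a) by rewrite es addrC addKr scalerA mulVf // scale1r.
  by rewrite /affine_pt /u /k; ptfield.
have ed : d = affine_pt o u v 0 (- m).
  have -> : d = t^-1 *: (o - (1 - t) *: b) by rewrite et addrC addKr scalerA mulVf // scale1r.
  by rewrite /affine_pt /v /m; ptfield.
have nD : det2 u v != 0.
  move: nabc; rewrite ea eb ec orient_affine mulf_eq0 => /norP[]; exact.
have sgn (e f : R) : (e = 1 \/ e = -1) -> (f = 1 \/ f = -1) -> det2 (e *: u) (f *: v) != 0.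
  move=> he hf; have -> : det2 (e *: u) (f *: v) = e * f * det2 u v by rewrite /det2 !coordE; ring.
  by case: he => ->; case: hf => ->; rewrite !mulf_neq0 // ?oppr_eq0 oner_eq0.
rewrite ea in Pa; rewrite eb in Pb; rewrite ec in Pc; rewrite ed in Pd.
have axes x y : P (affine_pt o u v x y) -> x = 0 \/ y = 0.
  move=> Pxy; have [->|x0] := eqVneq x 0; first by left.
  have [->|y0] := eqVneq y 0; first by right.
  exfalso.
  have [e [he [ex [r1 [r2 [r10 r20 Pr1 Pr2]]]]]] : exists e : R, (e = 1 \/ e = -1) /\ (0 < e * x /\
     exists r1 r2 : R, [/\ 0 < r1, 0 < r2, P (affine_pt o u v (e * r1) 0) & P (affine_pt o u v (e * - r2) 0)]).
    case: (ltrgt0P x) x0 => // x0 _.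
      by exists 1; split; [left|rewrite mul1r; split=> //; exists 1, k; rewrite !mul1r ltr01].
    exists (-1); split; [by right|split; first lra].
    by exists k, 1; rewrite !mulN1r opprK ltr01.
  have [f [hf [fy [q1 [q2 [q10 q20 Pq1 Pq2]]]]]] : exists f : R, (f = 1 \/ f = -1) /\ (0 < f * y /\
     exists r1 r2 : R, [/\ 0 < r1, 0 < r2, P (affine_pt o u v 0 (f * r1)) & P (affine_pt o u v 0 (f * - r2))]).
    case: (ltrgt0P y) y0 => // y0 _.
      by exists 1; split; [left|rewrite mul1r; split=> //; exists 1, m; rewrite !mul1r ltr01].
    exists (-1); split; [by right|split; first lra].
    by exists m, 1; rewrite !mulN1r opprK ltr01.
  apply: (@crossing_cone P o (e *: u) (f *: v) r1 q1 r2 q2 (e * x) (f * y)) => //;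
    rewrite ?affine_sign ?mulr0 //; first exact: sgn.
  by rewrite !mulrA; case: he => ->; case: hf => ->; rewrite ?mulrNN ?mulr1 ?mul1r.
(* A further point on [ac] makes [ac] the axis; without one, [bd] is the axis and [a], [c] are the
   two exceptional points. *)
have [[x [x0 xk Px]]|nox] := pselect (exists x, [/\ x != 0, x != 1 /\ x != - k & P (affine_pt o u v x 0)]); last first.
  apply: (@thinI P b d a c) => //.
    rewrite ea eb ec ed !orient_affine.
    have -> : det2 u v * ((0 - 0) * (0 - 1) - (- m - 1) * (1 - 0)) *
      (det2 u v * ((0 - 0) * (0 - 1) - (- m - 1) * (- k - 0))) = - (det2 u v ^+ 2 * ((m + 1) ^+ 2 * k)) by ring.
    rewrite oppr_lt0; apply: mulr_gt0; first by rewrite exprn_even_gt0.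
  by apply: mulr_gt0 => //; rewrite exprn_even_gt0 //= gt_eqF //; lra.
  move=> z Pz; have [x [y ez]] := affineP o z nD; rewrite ez in Pz *.
  have [e|e] := axes _ _ Pz.
    by constructor 1; rewrite eb ed e orient_affine; ring.
  rewrite e in Pz *.
  have [->|x0] := eqVneq x 0; first by constructor 1; rewrite eb ed orient_affine; ring.
  have [->|x1] := eqVneq x 1; first by constructor 2.
  have [->|xk] := eqVneq x (- k); first by constructor 3.
  by case: nox; exists x.
apply: (@thinI P a c b d) => //.
  rewrite ea eb ec ed !orient_affine.
  have -> : det2 u v * ((- k - 1) * (1 - 0) - (0 - 0) * (0 - 1)) *
    (det2 u v * ((- k - 1) * (- m - 0) - (0 - 0) * (0 - 1))) = - (det2 u v ^+ 2 * ((k + 1) ^+ 2 * m)) by ring.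
  rewrite oppr_lt0; apply: mulr_gt0; first by rewrite exprn_even_gt0.
  by apply: mulr_gt0 => //; rewrite exprn_even_gt0 //= gt_eqF //; lra.
move=> z Pz; have [x' [y ez]] := affineP o z nD; rewrite ez in Pz *.
have [e|e] := axes _ _ Pz; last by constructor 1; rewrite ea ec e orient_affine; ring.
rewrite e in Pz *.
have [->|y0] := eqVneq y 0; first by constructor 1; rewrite ea ec orient_affine; ring.
have [->|y1] := eqVneq y 1; first by constructor 2.
have [->|ym] := eqVneq y (- m); first by constructor 3.
exfalso; case: xk => x1 xk.
(* The points 1 and [- h] lie on opposite rays and [r] joins one of them: that ray carries two
   points and the other at least one, as [crossing_two_rays] requires. *)
have ray (r h : R) (Q : R -> Prop) : 0 < h -> r != 0 -> r != 1 -> r != - h -> Q r -> Q 1 -> Q (- h) ->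
    exists e : R, (e = 1 \/ e = -1) /\ exists r1 r2 r3 : R,
      [/\ 0 < r1, r1 < r2, 0 < r3 & [/\ Q (e * r1), Q (e * r2) & Q (e * - r3)]].
  move=> h0 r0 r1 rh Qr Q1 Qh; case: (ltrgt0P r) r0 => // r0 _.
    exists 1; split; first by left.
    case: (ltrgtP r 1) r1 => // r1 _; [exists r, 1, h|exists 1, r, h]; rewrite !mul1r; split=> //; lra.
  exists (-1); split; first by right.
  case: (ltrgtP r (- h)) rh => // rh _; [exists h, (- r), 1|exists (- r), h, 1]; rewrite !mulN1r !opprK; split=> //; lra.
have [e1 [he [r1 [r2 [r3 [r10 r12 r30 [Q1 Q2 Q3]]]]]]] := ray x k (fun x => P (affine_pt o u v x 0)) k0 x0 x1 xk Px Pa Pc.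
have [f1 [hf [q1 [q2 [q3 [q10 q12 q30 [S1 S2 S3]]]]]]] := ray y m (fun y => P (affine_pt o u v 0 y)) m0 y0 y1 ym Pz Pb Pd.
apply: (@crossing_two_rays P o (e1 *: u) (f1 *: v) r1 r2 r3 q1 q2 q3) => //;
  rewrite ?affine_sign ?mulr0 //; exact: sgn.
Qed.

End Crossing.

(** * Sets without crossings *)

Section CrossFree.
Context {R : realType}.
Implicit Types (a b c d e o p q r x y z w : 'rV[R]_2) (A B P X : set 'rV[R]_2).

(** The points missing for [thin] are invented outside [P]: the reflection of [s] in [p], or, if [s]
    is on the line, [p + n] and [p - n] with [n] normal to it. *)
Lemma thin1 P p q s : finite_set P -> p != q ->
  (forall x, P x -> orient p q x = 0 \/ x = s) -> thin P.
Proof.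
move=> finP pq hP.
have [e|ne] := eqVneq (orient p q s) 0; last first.
  apply: (@thinI _ P p q s (p + (p - s))) => //.
    have -> : orient p q (p + (p - s)) = - orient p q s by rewrite /orient !coordE; ring.
    by rewrite mulrN oppr_lt0 -expr2 exprn_even_gt0.
  by move=> x /hP[]; [constructor 1|constructor 2].
pose n : 'rV[R]_2 := \row_i (if i == 0 then - (py q - py p) else px q - px p).
have nx : px n = - (py q - py p) by rewrite /px mxE.
have ny : py n = px q - px p by rewrite /py mxE.
apply: (@thinI _ P p q (p + n) (p - n)) => //; last first.
  by move=> x /hP[h|->]; constructor 1.
have -> : orient p q (p + n) * orient p q (p - n) = - ((px q - px p) ^+ 2 + (py q - py p) ^+ 2) ^+ 2.
  by rewrite /orient !coordE nx ny; ring.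
rewrite oppr_lt0 exprn_even_gt0 //= paddr_eq0 ?sqr_ge0 // !sqrf_eq0 !subr_eq0.
apply: contra pq => /andP[/eqP h1 /eqP h2]; apply/eqP; exact: pt_eq.
Qed.

Lemma collinear_thin P p q : finite_set P -> p != q ->
  (forall x, P x -> orient p q x = 0) -> thin P.
Proof. by move=> finP pq hP; apply: (@thin1 P p q p) => // x /hP; left. Qed.

Lemma orient0_rot a b c : orient a b c = 0 -> orient b c a = 0.
Proof. by move=> h; rewrite -orient_rot. Qed.

Lemma orient0_swap a b c : orient a b c = 0 -> orient b a c = 0.
Proof. by rewrite orient_swap => h; rewrite -[LHS]opprK h oppr0. Qed.

Lemma orient0_swapr a b c : orient a b c = 0 -> orient a c b = 0.
Proof. by move=> h; apply/orient0_rot/orient0_swap. Qed.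

Lemma col_trans a x y z : a != x -> orient a x y = 0 -> orient a x z = 0 -> orient a y z = 0.
Proof.
move=> ax h1 h2; have [t ->] := line_param ax h1.
transitivity (t * orient a x z); last by rewrite h2 mulr0.
by rewrite /orient !coordE; ring.
Qed.

Lemma col_two x y a b : x != y -> orient a x y = 0 -> orient b x y = 0 -> orient a b x = 0.
Proof.
rewrite ![orient _ x y]orient_rot => xy /(line_param xy)[t ->] /(line_param xy)[s ->].
by rewrite /orient !coordE; ring.
Qed.

(** Induction over the points: without crossings, Radon puts one of the three vertices and the new
    point into the triangle of the others, which then spans everything so far. *)
Lemma cross_free_hull P : cross_free P -> finite_set P -> P !=set0 ->
  exists a b c, [/\ P a, P b, P c & P `<=` tri a b c].
Proof.
move=> nP /finite_seqP[s Ps] [x0 Px0].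
have : exists a b c, [/\ P a, P b, P c & forall x, x \in s -> tri a b c x].
  have : forall x, x \in s -> P x by move=> x; rewrite Ps.
  elim: s {Ps} => [|p s ih] sP; first by exists x0, x0, x0.
  have [|a [b [c [Pa Pb Pc h]]]] := ih.
    by move=> x xs; apply: sP; rewrite inE xs orbT.
  have Pp : P p by apply: sP; rewrite inE eqxx.
  have suf a' b' c' : P a' -> P b' -> P c' -> tri a' b' c' a -> tri a' b' c' b ->
     tri a' b' c' c -> tri a' b' c' p ->
     exists a b c, [/\ P a, P b, P c & forall x, x \in p :: s -> tri a b c x].
    move=> Pa' Pb' Pc' ta tb tc tp; exists a', b', c'; split=> // x.
    by rewrite inE => /orP[/eqP->//|/h]; exact: tri_sub.
  case: (cross_free_radon nP Pa Pb Pc Pp) => k.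
  - by apply: (suf b c p) => //; [exact: tri1|exact: tri2|exact: tri3].
  - by apply: (suf a c p) => //; [exact: tri1|exact: tri2|exact: tri3].
  - by apply: (suf a b p) => //; [exact: tri1|exact: tri2|exact: tri3].
  - by apply: (suf a b c) => //; [exact: tri1|exact: tri2|exact: tri3].
by case=> a [b [c [Pa Pb Pc h]]]; exists a, b, c; split=> // x; rewrite Ps; exact: h.
Qed.

Definition frame P a b c :=
  [/\ P a, P b, P c, orient a b c != 0 & P `<=` tri a b c].

Lemma frame_rot P a b c : frame P a b c -> frame P b c a.
Proof. by case=> *; split=> //; [rewrite -orient_rot|move=> x Px; apply: tri_rot; auto]. Qed.

Lemma frame_swap P a b c : frame P a b c -> frame P b a c.
Proof.
by case=> *; split=> //; [rewrite orient_swap oppr_eq0|move=> x Px; apply: triC; auto].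
Qed.

Lemma frame_neq P a b c : frame P a b c -> [/\ a != b, b != c & a != c].
Proof.
case=> _ _ _ h _; split; apply: contra_neq h => ->;
 by rewrite ?orientaab ?orientabb ?orientaba.
Qed.

(** Vertices are extreme: the barycentric weight at [a] is at most 1 on [P], with equality only at
    [a], so an average of three such weights equals 1 only if [a] is among the points. *)
Lemma frame_extreme P a b c p q r : frame P a b c -> P p -> P q -> P r ->
  tri p q r a -> [\/ a = p, a = q | a = r].
Proof.
move=> [_ _ _ nD PT] /PT[x1 [y1 [w1 [x10 y10 w10 h1 ep]]]] /PT[x2 [y2 [w2 [x20 y20 w20 h2 eq]]]].
move=> /PT[x3 [y3 [w3 [x30 y30 w30 h3 er]]]] [k1 [k2 [k3 [k10 k20 k30 hk ea]]]].
have e0 (s t u : R) : 0 <= s -> 0 <= t -> 0 <= u -> s + t + u = 1 -> s = 1 ->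
   s *: a + t *: b + u *: c = a.
  move=> s0 t0 u0 h hs; have t00 : t = 0 by lra.
  have u00 : u = 0 by lra.
  by rewrite hs t00 u00 scale1r !scale0r !addr0.
have [E1|N1] := eqVneq x1 1; first by constructor 1; rewrite ep e0.
have [E2|N2] := eqVneq x2 1; first by constructor 2; rewrite eq e0.
have [E3|N3] := eqVneq x3 1; first by constructor 3; rewrite er e0.
have L1 : x1 < 1 by rewrite lt_neqAle N1; lra.
have L2 : x2 < 1 by rewrite lt_neqAle N2; lra.
have L3 : x3 < 1 by rewrite lt_neqAle N3; lra.
have H : k1 * x1 + k2 * x2 + k3 * x3 = 1.
  have := congr1 (orient b c) ea.
  rewrite orient_comb // ep eq er !orient_comb // !orientaba !orientabb !mulr0 !addr0.
  rewrite !mulrA -!mulrDl -orient_rot -{1}[orient a b c]mul1r => /(mulIf nD)/esym; exact.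
have m1 : 0 <= k1 * (1 - x1) by rewrite mulr_ge0 //; lra.
have m2 : 0 <= k2 * (1 - x2) by rewrite mulr_ge0 //; lra.
have m3 : 0 <= k3 * (1 - x3) by rewrite mulr_ge0 //; lra.
have Z1 : k1 * (1 - x1) = 0 by lra.
have Z2 : k2 * (1 - x2) = 0 by lra.
have Z3 : k3 * (1 - x3) = 0 by lra.
move/eqP: Z1; rewrite mulf_eq0 subr_eq0 [1 == _]eq_sym (negbTE N1) orbF => /eqP Z1.
move/eqP: Z2; rewrite mulf_eq0 subr_eq0 [1 == _]eq_sym (negbTE N2) orbF => /eqP Z2.
move/eqP: Z3; rewrite mulf_eq0 subr_eq0 [1 == _]eq_sym (negbTE N3) orbF => /eqP Z3.
lra.
Qed.

(** Only the vertices are excluded; points on the edges still count. *)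
Definition inner P a b c x := [/\ P x, x != a, x != b & x != c].

Lemma inner_rot P a b c x : inner P a b c x -> inner P b c a x.
Proof. by case. Qed.

Lemma inner_swap P a b c x : inner P a b c x -> inner P b a c x.
Proof. by case. Qed.

(** [h] stands for an affine function vanishing on the line [xy]. As it has one strict sign at [a]
    and [b], their weights in [x] must be zero. *)
Lemma same_side_tri a b x y (h : 'rV[R]_2 -> R) :
  0 < h a * h b -> h y = 0 -> h x = 0 ->
  (forall u v w : R, u + v + w = 1 -> h (u *: a + v *: b + w *: y) = u * h a + v * h b + w * h y) ->
  tri a b y x -> x = y.
Proof.
move=> hab hy hx lin [u [v [w [u0 v0 w0 hs e]]]].
have := lin u v w hs; rewrite -e hx hy mulr0 addr0 => /esym E.
have [ha hb] : h a != 0 /\ h b != 0.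
  by apply/andP; rewrite -negb_or -mulf_eq0 gt_eqF.
have E2 : u * (h a * h a) + v * (h a * h b) = 0.
  by transitivity ((u * h a + v * h b) * h a); [ring|rewrite E mul0r].
have g1 : 0 < h a * h a by rewrite -expr2 exprn_even_gt0.
have k1 := mulr_ge0 u0 (ltW g1); have k2 := mulr_ge0 v0 (ltW hab).
have U : u * (h a * h a) = 0 by lra.
have V : v * (h a * h b) = 0 by lra.
move/eqP: U; rewrite mulf_eq0 [_ * _ == 0]gt_eqF // orbF => /eqP U.
move/eqP: V; rewrite mulf_eq0 [_ * _ == 0]gt_eqF // orbF => /eqP V.
have W : w = 1 by lra.
by rewrite e U V W !scale0r !add0r scale1r.
Qed.

(** Every case of Radon for [a], [b], [x], [y] fails: vertices are extreme, and [same_side_tri]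
    keeps [x] and [y] out of the other two triangles. *)
Lemma frame_side P a b c x y : cross_free P -> frame P a b c ->
  inner P a b c x -> inner P a b c y -> x != y -> orient x y a * orient x y b <= 0.
Proof.
move=> nP F [Px xa xb xc] [Py ya yb yc] xy; rewrite leNgt; apply/negP => h.
have [Pa Pb Pc nD PT] := F; have [ab bc ac] := frame_neq F.
have lin z (u v w : R) : u + v + w = 1 ->
  orient x y (u *: a + v *: b + w *: z) = u * orient x y a + v * orient x y b + w * orient x y z.
  by move=> ?; rewrite orient_comb.
case: (cross_free_radon nP Pa Pb Px Py) => k.
- case: (frame_extreme F Pb Px Py k) => e.
  + by rewrite e eqxx in ab. + by rewrite e eqxx in xa. + by rewrite e eqxx in ya.
- case: (frame_extreme (frame_rot F) Pa Px Py k) => e.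
  + by rewrite e eqxx in ab. + by rewrite e eqxx in xb. + by rewrite e eqxx in yb.
- case/eqP: xy; apply: (@same_side_tri a b x y (orient x y) h _ _ (lin y) k); [exact: orientabb|exact: orientaba].
- case/eqP: xy; apply/esym; apply: (@same_side_tri a b y x (orient x y) h _ _ (lin x) k); [exact: orientaba|exact: orientabb].
Qed.

(* Two vertices strictly on the same side of the line xy would form a strictly
   convex quadrilateral with x and y. *)
Lemma frame_line P a b c x y : cross_free P -> frame P a b c ->
  inner P a b c x -> inner P a b c y -> x != y ->
  [\/ orient a x y = 0, orient b x y = 0 | orient c x y = 0].
Proof.
move=> nP F Ix Iy xy.
have h1 := frame_side nP F Ix Iy xy.
have h2 := frame_side nP (frame_rot F) (inner_rot Ix) (inner_rot Iy) xy.
have h3 := frame_side nP (frame_rot (frame_rot F)) (inner_rot (inner_rot Ix)) (inner_rot (inner_rot Iy)) xy.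
rewrite !(orient_rot _ x y).
have [ha|ha|ha] := ltrgt0P (orient x y a); last by constructor 1.
- have [hb|hb|hb] := ltrgt0P (orient x y b); last by constructor 2.
    by move: h1; rewrite leNgt mulr_gt0.
  have [hc|hc|hc] := ltrgt0P (orient x y c); last by constructor 3.
    by move: h3; rewrite leNgt mulr_gt0.
  by move: h2; rewrite leNgt -mulrNN mulr_gt0 // oppr_gt0.
- have [hb|hb|hb] := ltrgt0P (orient x y b); last by constructor 2.
    have [hc|hc|hc] := ltrgt0P (orient x y c); last by constructor 3.
      by move: h2; rewrite leNgt mulr_gt0.
    by move: h3; rewrite leNgt -mulrNN mulr_gt0 // oppr_gt0.
  by move: h1; rewrite leNgt -mulrNN mulr_gt0 // oppr_gt0.
Qed.

(** With barycentric weights [u], [v] at [a], [b], the product is [- (u * v * orient a b c ^+ 2)];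
    the hypotheses say that [u] and [v] are nonzero. *)
Lemma frame_opposite P a b c x : frame P a b c -> P x ->
  orient b c x != 0 -> orient a c x != 0 -> orient c x a * orient c x b < 0.
Proof.
move=> [_ _ _ nD PT] /PT[u [v [w [u0 v0 w0 hs ->]]]] hb ha.
have un : u != 0.
  by apply: contra hb => /eqP hu; rewrite orient_comb // hu orientaba orientabb mul0r !mulr0 !addr0.
have vn : v != 0.
  by apply: contra ha => /eqP hv; rewrite orient_comb // hv orientaba orientabb mul0r !mulr0 !addr0.
have -> : w = 1 - u - v by lra.
have -> : orient c (u *: a + v *: b + (1 - u - v) *: c) a * orient c (u *: a + v *: b + (1 - u - v) *: c) b
  = - (u * v * orient a b c ^+ 2) by rewrite /orient !coordE; ring.
rewrite oppr_lt0; apply: mulr_gt0; last by rewrite exprn_even_gt0.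
by apply: mulr_gt0; rewrite lt_neqAle eq_sym ?un ?vn.
Qed.

(** A point off the line [ab] can be joined to an inner point of [ab] only through [c], since a line
    through [a] or [b] would be [ab] itself. So one inner point [x] off [ab] forces everything
    except [a] and [b] onto the line [cp]; without such a point the axis is [ab]. *)
Lemma frame_edge P a b c p : finite_set P -> cross_free P -> frame P a b c ->
  inner P a b c p -> orient a b p = 0 -> thin P.
Proof.
move=> finP nP F Ip hp; have [Pa Pb Pc nD PT] := F; have [ab bc ac] := frame_neq F.
have [Pp pa pb pc] := Ip.
have [hx|] := pselect (forall x, P x -> orient a b x = 0 \/ x = c).
  exact: thin1 hx.
move/existsNP => [x /not_implyP[Px /not_orP[nx xc]]].
have Ix : inner P a b c x.
  split=> //; apply/eqP => e; first by apply: nx; rewrite e orientaba.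
    by apply: nx; rewrite e orientabb.
  exact: xc.
have px : p != x by apply: contra_notN nx => /eqP <-.
have onab y z : inner P a b c y -> orient a b y = 0 -> orient a y z = 0 \/ orient b y z = 0 -> orient a b z = 0.
  move=> [_ ya yb _] hy [h|h].
    by apply: (@col_trans a y) => //; [rewrite eq_sym|exact: orient0_swapr].
  by apply/orient0_swap/(@col_trans b y) => //; [rewrite eq_sym|exact: orient0_rot].
have hcx : orient c p x = 0.
  case: (frame_line nP F Ip Ix px) => // h; exfalso; apply: nx; apply: (onab p) => //; by [left|right].
apply: (@thinI _ P c p a b) => //.
  apply: (frame_opposite F Pp).
    apply: contra nD => /eqP h; apply/eqP/orient0_swap.
    apply: (@col_trans b p); [by rewrite eq_sym|exact: orient0_rot|exact: orient0_swapr].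
  apply: contra nD => /eqP h; apply/eqP.
  by apply: (@col_trans a p); [by rewrite eq_sym|exact: orient0_swapr|exact: orient0_swapr].
move=> y Py.
have [->|ya] := eqVneq y a; first by constructor 2.
have [->|yb] := eqVneq y b; first by constructor 3.
constructor 1.
have [->|yc] := eqVneq y c; first exact: orientaba.
have [->|yp] := eqVneq y p; first exact: orientabb.
have Iy : inner P a b c y by [].
case: (frame_line nP F Ip Iy); rewrite 1?eq_sym // => h.
- have hy : orient a b y = 0 by apply: (onab p) => //; left.
  have xy : y != x by apply: contra_notN nx => /eqP <-.
  case: (frame_line nP F Iy Ix xy) => k.
  + by case: nx; apply: (onab y) => //; left.
  + by case: nx; apply: (onab y) => //; right.
  + apply: (@col_trans c x); first by rewrite eq_sym; case: Ix.
    * exact: orient0_swapr.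
    * exact: orient0_swapr.
- have hy : orient a b y = 0 by apply: (onab p) => //; right.
  have xy : y != x by apply: contra_notN nx => /eqP <-.
  case: (frame_line nP F Iy Ix xy) => k.
  + by case: nx; apply: (onab y) => //; left.
  + by case: nx; apply: (onab y) => //; right.
  + apply: (@col_trans c x); first by rewrite eq_sym; case: Ix.
    * exact: orient0_swapr.
    * exact: orient0_swapr.
Qed.

End CrossFree.

(** * Triangles of inner points with three colours *)

Section Rainbow.
Context {R : realType}.
Implicit Types (a b c d e o p q r x y z w : 'rV[R]_2) (A B P X : set 'rV[R]_2).

(* The incidences of S_6; noncollinearity of a', b', c' implies that of all the
   triples not listed here. *)
Definition pinwheel a b c a' b' c' :=
  [/\ btw a a' c', btw b b' a', btw c c' b' & orient a' b' c' != 0].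

Definition strict_frame P a b c := [/\ cross_free P, frame P a b c &
  forall x, inner P a b c x ->
    [/\ orient a b x != 0, orient b c x != 0 & orient c a x != 0]].

Lemma orient_neq0_swap a b c : orient a b c != 0 -> orient b a c != 0.
Proof. by apply: contra => /eqP/orient0_swap->. Qed.

Lemma strict_rot P a b c : strict_frame P a b c -> strict_frame P b c a.
Proof.
case=> nP F h; split=> //; first exact: frame_rot.
by move=> x /inner_rot/inner_rot/h[].
Qed.

Lemma strict_swap P a b c : strict_frame P a b c -> strict_frame P b a c.
Proof.
case=> nP F h; split=> //; first exact: frame_swap.
by move=> x /inner_swap/h[*]; split; exact: orient_neq0_swap.
Qed.

(** A pair has at most one colour: two vertices on the line [xy] would put [x] on a line through two
    vertices. *)
Lemma strict_excl P a b c x y : strict_frame P a b c -> inner P a b c x -> x != y ->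
  orient a x y = 0 -> orient b x y = 0 -> False.
Proof. by case=> _ _ h /h[/eqP n _ _] xy h1 h2; apply: n; exact: col_two h1 h2. Qed.

(** The third order, with [a] in the middle, is impossible because [a] is extreme. *)
Lemma strict_order P a b c x y : strict_frame P a b c -> inner P a b c x ->
  inner P a b c y -> x != y -> orient a x y = 0 -> btw a x y \/ btw a y x.
Proof.
move=> [nP F _] [Px xa _ _] [Py ya _ _] xy /col_seg[] /[dup] h /seg_cases[] e.
- by rewrite e eqxx in ya. - by rewrite e eqxx in xy. - by right.
- by rewrite e eqxx in xa. - by rewrite e eqxx in ya.
- case: (frame_extreme F Px Px Py (seg_tri h)) => k.
  + by rewrite k eqxx in xa. + by rewrite k eqxx in xa. + by rewrite k eqxx in ya.
- by rewrite e eqxx in xa. - by rewrite e eqxx in xy. - by left.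
Qed.

Definition rainbow P a b c x y z :=
  [/\ inner P a b c x, inner P a b c y, inner P a b c z,
      [/\ x != y, x != z & y != z] &
      [/\ orient a x y = 0, orient b x z = 0 & orient c y z = 0]].

Lemma rainbow_swap P a b c x y z : rainbow P a b c x y z -> rainbow P b a c x z y.
Proof.
case=> Ix Iy Iz [xy xz yz] [ha hb hc]; split; try exact: inner_swap.
  by split=> //; rewrite eq_sym.
by split=> //; exact: orient0_swapr.
Qed.

Lemma rainbow_swapr P a b c x y z : rainbow P a b c x y z -> rainbow P a c b y x z.
Proof.
case=> Ix Iy Iz [xy xz yz] [ha hb hc].
have sw u : inner P a b c u -> inner P a c b u by case.
split; try exact: sw; split=> //; first by rewrite eq_sym.
exact: orient0_swapr.
Qed.

Lemma strict_swapr P a b c : strict_frame P a b c -> strict_frame P a c b.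
Proof. by move=> /strict_swap/strict_rot. Qed.

Lemma cross_sharp P a b p x y : cross_free P -> P a -> P b -> P x -> P y ->
  orient a b p != 0 -> btw a p x -> btw b p y -> False.
Proof.
move=> nP Pa Pb Px Py n h1 h2; apply: (nP a b x y p) => //; split=> //.
case: h1 => t [t0 t1 e]; apply: contra n => /eqP h.
by rewrite e orient_comb2 orientaba h !mulr0 addr0.
Qed.

(** The order on one side fixes the others. Given [y] between [a] and [x], having [y] also between
    [c] and [z] would be a crossing at [y], so [z] lies between [c] and [y]; the same argument at
    [z] places [x] between [b] and [z]. *)
Lemma rainbow_pinwheel P a b c x y z : strict_frame P a b c -> rainbow P a b c x y z ->
  btw a y x -> pinwheel a c b y z x.
Proof.
move=> S; have [nP F ne] := S; have [Pa Pb Pc nD PT] := F.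
move=> [Ix Iy Iz [xy xz yz] [ha hb hc]] hayx.
have [Px _ _ _] := Ix; have [Py _ _ _] := Iy; have [Pz _ _ _] := Iz.
have [_ _ nca] := ne _ Iy; have [_ nbc _] := ne _ Iz.
have rot u : inner P a b c u -> inner P b c a u by case.
have rot2 u : inner P a b c u -> inner P c a b u by case.
have hczy : btw c z y.
  case: (strict_order (strict_rot (strict_rot S)) (rot2 _ Iy) (rot2 _ Iz) yz hc) => // k.
  by exfalso; apply: (cross_sharp nP Pc Pa Pz Px nca).
have hbxz : btw b x z.
  case: (strict_order (strict_rot S) (rot _ Ix) (rot _ Iz) xz hb) => // k.
  by exfalso; apply: (cross_sharp nP Pb Pc Px Py nbc).
split=> //; apply/eqP => h.
apply: (strict_excl S Ix xz _ hb).
apply: orient0_swap; apply: (@col_trans _ x y) => //; first exact: orient0_rot.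
by do 2!apply: orient0_rot.
Qed.

(* Equal colours at a point are transitive, so a fourth point w can be joined to
   x, y and z only by the respective missing colours c, b and a. *)
Lemma rainbow_fourth P a b c x y z w : strict_frame P a b c -> rainbow P a b c x y z ->
  inner P a b c w -> w != x -> w != y -> w != z -> orient a x w = 0 -> False.
Proof.
move=> S [Ix Iy Iz [xy xz yz] [ha hb hc]] Iw wx wy wz h.
have [nP F ne] := S.
have [[_ xa _ _] [_ wa wb wc] [_ za zb zc]] := And3 Ix Iw Iz.
have hy : orient a y w = 0 by apply: (@col_trans _ a x) => //; rewrite eq_sym.
case: (frame_line nP F Iw Iz wz) => k.
- apply: (strict_excl S Ix xz _ hb).
  by apply: (@col_trans _ a w) => //; [rewrite eq_sym|exact: orient0_swapr].
- apply: (strict_excl S Ix (y := w) _ h); first by rewrite eq_sym.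
  by apply/orient0_swapr/(@col_trans _ b z); [rewrite eq_sym|exact: orient0_swapr|exact: orient0_swapr].
- apply: (strict_excl (strict_swapr S) (y := w) _ _ hy).
  + by case: Iy.
  + by rewrite eq_sym.
  + by apply/orient0_swapr/(@col_trans _ c z); [rewrite eq_sym|exact: orient0_swapr|exact: orient0_swapr].
Qed.

(* The line through s and p leaves the triangle q r s through the edge qr, but
   it meets the line qr in v, which is outside that edge. *)
Lemma inside_vertex P v b c p q r s : strict_frame P v b c ->
  inner P v b c q -> inner P v b c r -> q != r -> s != p -> v != s ->
  orient v s p = 0 -> orient v q r = 0 -> orient v s q != 0 -> ~ tri q r s p.
Proof.
move=> S Iq Ir qr sp vs hsp hqr nsq k.
have lin (u t w : R) : u + t + w = 1 ->
   orient v s (u *: q + t *: r + w *: s) = u * orient v s q + t * orient v s r + w * orient v s s.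
  by move=> ?; rewrite orient_comb.
suff h : 0 < orient v s q * orient v s r.
  case/eqP: sp; apply/esym; apply: (@same_side_tri _ q r p s (orient v s) h _ _ lin k) => //.
  exact: orientabb.
have g : 0 < orient v s q * orient v s q by rewrite -expr2 exprn_even_gt0.
case: (strict_order S Iq Ir qr hqr) => -[t [t0 t1 e]].
  have E : orient v s q = t * orient v s r by rewrite e orient_comb2 orientaba mulr0 add0r.
  have E2 : orient v s q * orient v s r = t^-1 * (orient v s q * orient v s q).
    by rewrite {3}E; field; rewrite gt_eqF.
  by rewrite E2 mulr_gt0 // invr_gt0.
have -> : orient v s r = t * orient v s q by rewrite e orient_comb2 orientaba mulr0 add0r.
by rewrite mulrCA mulr_gt0.
Qed.

(** A fourth point would make the colour classes the three perfect matchings: [xy], [zw] through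
    [a]; [xz], [yw] through [b]; [yz], [xw] through [c]. Whichever of the four points Radon puts
    into the triangle of the others, [inside_vertex] applied to one matching excludes it. *)
Lemma rainbow_all P a b c x y z w : strict_frame P a b c -> rainbow P a b c x y z ->
  inner P a b c w -> [\/ w = x, w = y | w = z].
Proof.
move=> S Rb Iw; have [nP F ne] := S.
have [->|wx] := eqVneq w x; first by constructor 1.
have [->|wy] := eqVneq w y; first by constructor 2.
have [->|wz] := eqVneq w z; first by constructor 3.
exfalso.
have Iw1 : inner P b a c w by case: Iw.
have Iw2 : inner P a c b w by case: Iw.
have Iw3 : inner P c a b w by case: Iw.
have Iw4 : inner P b c a w by case: Iw.
have [Ix Iy Iz [xy xz yz] [ha hb hc]] := Rb.
have S1 := strict_swap S; have S2 := strict_swapr S.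
have R1 := rainbow_swap Rb; have R2 := rainbow_swapr Rb.
have nax := rainbow_fourth S Rb Iw wx wy wz.
have nbx := rainbow_fourth S1 R1 Iw1 wx wz wy.
have nay := rainbow_fourth S2 R2 Iw2 wy wx wz.
have ncy := rainbow_fourth (strict_swap S2) (rainbow_swap R2) Iw3 wy wz wx.
have nbz := rainbow_fourth (strict_swapr S1) (rainbow_swapr R1) Iw4 wz wx wy.
have xw : x != w by rewrite eq_sym.
have yw : y != w by rewrite eq_sym.
have zw : z != w by rewrite eq_sym.
have hcx : orient c x w = 0 by case: (frame_line nP F Ix Iw xw).
have hby : orient b y w = 0 by case: (frame_line nP F Iy Iw yw).
have haz : orient a z w = 0.
  case: (frame_line nP F Iz Iw zw) => // h; exfalso.
  have ncz := rainbow_fourth (strict_swap (strict_swapr S1)) (rainbow_swap (rainbow_swapr R1)) .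
  apply: (ncz w) => //; by case: Iw.
have [[Px xa xb xc] [Py ya yb yc] [Pz za zb zc]] := And3 Ix Iy Iz.
have [Pw wa wb wc] := Iw.
have I3 u : inner P a b c u -> inner P c a b u by case.
have I4 u : inner P a b c u -> inner P b a c u by case.
case: (cross_free_radon nP Px Py Pz Pw) => k.
- apply: (@inside_vertex P c a b x y z w _ (I3 _ Iy) (I3 _ Iz)) => //.
  + exact: strict_rot (strict_rot S).
  + by rewrite eq_sym.
  + exact: orient0_swapr.
  + apply/eqP => h; apply: ncy; exact: orient0_swapr.
- apply: (@inside_vertex P b a c y x z w S1 (I4 _ Ix) (I4 _ Iz)) => //.
  + by rewrite eq_sym.
  + exact: orient0_swapr.
  + apply/eqP => h; apply: nbx; exact: orient0_swapr.
- apply: (@inside_vertex P a b c z x y w S Ix Iy) => //.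
  + by rewrite eq_sym.
  + exact: orient0_swapr.
  + apply/eqP => h; apply: nax; exact: orient0_swapr.
- apply: (@inside_vertex P a b c w x y z S Ix Iy) => //.
  + by rewrite eq_sym.
  + apply/eqP => h; apply: (strict_excl S Ix xz _ hb); exact: orient0_swapr.
Qed.

End Rainbow.

(** * Classification of finite crossing-closed sets, and how their subsets behave *)

Section Classification.
Context {R : realType}.
Implicit Types (a b c d e o p q r x y z w : 'rV[R]_2) (A B P X Y : set 'rV[R]_2).

Definition sporadic_like X := exists a b c a' b' c',
  pinwheel a b c a' b' c' /\ X = [set` [:: a; b; c; a'; b'; c']].

(** If [yz] had colour [a] or [b], transitivity along the line through that vertex would give [xz]
    or [xy] a second colour. *)
Lemma mk_rainbow P a b c x y z : strict_frame P a b c ->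
  inner P a b c x -> inner P a b c y -> inner P a b c z -> x != y -> x != z ->
  orient a x y = 0 -> orient b x z = 0 -> rainbow P a b c x y z.
Proof.
move=> S Ix Iy Iz xy xz ha hb; have [nP F _] := S.
have yz : y != z.
  by apply/eqP => e; apply: (strict_excl S Ix xy ha); rewrite e.
split=> //; split=> //; case: (frame_line nP F Iy Iz yz) => // k; exfalso.
- apply: (strict_excl S Ix xz _ hb); apply: (@col_trans _ a y); first by case: Iy; rewrite eq_sym.
    exact: orient0_swapr.
  exact: k.
- apply: (strict_excl S Ix xy ha); apply: (@col_trans _ b z); first by case: Iz; rewrite [b == _]eq_sym.
    exact: orient0_swapr.
  exact: orient0_swapr.
Qed.

Lemma rainbow_sporadic P a b c x y z : strict_frame P a b c ->
  rainbow P a b c x y z -> sporadic_like P.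
Proof.
move=> S Rb; have [nP [Pa Pb Pc nD _] _] := S; have [Ix Iy Iz [xy _ _] [ha _ _]] := Rb.
have PE u : P u <-> [\/ u = a, u = b | u = c] \/ [\/ u = x, u = y | u = z].
  split; last first.
    by case: Ix => ? _ _ _; case: Iy => ? _ _ _; case: Iz => ? _ _ _ [[]|[]] ->.
  move=> Pu; have [->|ua] := eqVneq u a; first by left; constructor 1.
  have [->|ub] := eqVneq u b; first by left; constructor 2.
  have [->|uc] := eqVneq u c; first by left; constructor 3.
  by right; exact: (rainbow_all S Rb).
case: (strict_order S Ix Iy xy ha) => h.
  have := rainbow_pinwheel (strict_swapr S) (rainbow_swapr Rb) h.
  exists a, b, c, x, z, y; split=> //; rewrite eqEsubset; split=> u /=.
    by move/PE => [[]|[]] ->; rewrite !inE eqxx ?orbT.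
  by rewrite !inE => h'; apply/PE; case/or4P: h' => [| | |/or3P[]] /eqP->;
    first [left; by constructor 1 | left; by constructor 2 | left; by constructor 3
          |right; by constructor 1 | right; by constructor 2 | right; by constructor 3].
have := rainbow_pinwheel S Rb h.
exists a, c, b, y, z, x; split=> //; rewrite eqEsubset; split=> u /=.
  by move/PE => [[]|[]] ->; rewrite !inE eqxx ?orbT.
by rewrite !inE => h'; apply/PE; case/or4P: h' => [| | |/or3P[]] /eqP->;
    first [left; by constructor 1 | left; by constructor 2 | left; by constructor 3
          |right; by constructor 1 | right; by constructor 2 | right; by constructor 3].
Qed.

Lemma strict_axis_thin P a b c x : finite_set P -> strict_frame P a b c ->
  inner P a b c x -> (forall y, inner P a b c y -> orient a x y = 0) -> thin P.
Proof.
move=> finP S Ix h; have [nP F ne] := S; have [n1 n2 n3] := ne _ Ix; have [Px _ _ _] := Ix.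
apply: (@thinI _ P a x b c) => //.
  by apply: (frame_opposite (frame_rot F)) => //; exact: orient_neq0_swap.
move=> y Py; have [->|ya] := eqVneq y a; first by constructor 1; exact: orientaba.
have [->|yb] := eqVneq y b; first by constructor 2.
have [->|yc] := eqVneq y c; first by constructor 3.
by constructor 1; apply: h.
Qed.

Lemma cross_free_classification P : cross_free P -> finite_set P -> P !=set0 ->
  thin P \/ sporadic_like P.
Proof.
move=> nP finP P0; have [a [b [c [Pa Pb Pc PT]]]] := cross_free_hull nP finP P0.
have [h|nD] := eqVneq (orient a b c) 0.
  left; have [eab|ab] := eqVneq a b; last first.
    apply: (collinear_thin finP ab) => x /PT[u [v [w [_ _ _ hs ->]]]].
    by rewrite orient_comb // orientaba orientabb h !mulr0 !addr0.
  rewrite -eab in PT; have [eac|ac] := eqVneq a c; last first.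
    apply: (collinear_thin finP ac) => x /PT[u [v [w [_ _ _ hs ->]]]].
    by rewrite orient_comb // orientaba orientabb !mulr0 !addr0.
  (* All three vertices coincide, so [P] is one point; any second point supplies a line. *)
  apply: (@collinear_thin _ P a (a + const_mx 1)) => //.
    by rewrite -subr_eq0 opprD addNKr oppr_eq0; apply/eqP => /(congr1 (@px R)); rewrite /px !mxE; apply/eqP; rewrite oner_eq0.
  move=> x /PT[u [v [w [_ _ _ hs ->]]]].
  by rewrite orient_comb // -eac orientaba !mulr0 !addr0.
have F : frame P a b c by [].
have [[x [Ix hx]]|noedge] := pselect (exists x, inner P a b c x /\
    [\/ orient a b x = 0, orient b c x = 0 | orient c a x = 0]).
  left; case: hx => hx.
  - exact: (frame_edge finP nP F Ix).
  - exact: (frame_edge finP nP (frame_rot F) (inner_rot Ix)).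
  - exact: (frame_edge finP nP (frame_rot (frame_rot F)) (inner_rot (inner_rot Ix))).
have S : strict_frame P a b c.
  split=> // x Ix; split; apply/eqP => h; apply: noedge; exists x; split=> //.
  - by constructor 1. - by constructor 2. - by constructor 3.
have [[x Ix]|nox] := pselect (exists x, inner P a b c x); last first.
  left; apply: (@thin1 _ P a b c) => //; first by have [] := frame_neq F.
  move=> x Px; have [->|xa] := eqVneq x a; first by left; exact: orientaba.
  have [->|xb] := eqVneq x b; first by left; exact: orientabb.
  have [->|xc] := eqVneq x c; first by right.
  by case: nox; exists x.
have two a' b' c' y z : strict_frame P a' b' c' -> inner P a' b' c' x -> inner P a' b' c' y -> inner P a' b' c' z ->
    x != y -> x != z -> orient a' x y = 0 -> orient b' x z = 0 -> sporadic_like P.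
  by move=> S' Jx Jy Jz xy xz h1 h2; exact: rainbow_sporadic (mk_rainbow S' Jx Jy Jz xy xz h1 h2).
have S1 := strict_rot S; have S2 := strict_rot S1.
have I1 u : inner P a b c u -> inner P b c a u by case.
have I2 u : inner P a b c u -> inner P c a b u by case.
(* If all inner points see [x] in one colour, the set is thin. Otherwise some pair at [x] avoids
   each colour, and among these pairs two have different colours, which is the input of
   [mk_rainbow]. *)
have [ha|/existsNP[y1 /not_implyP[Iy1 n1]]] := pselect (forall y, inner P a b c y -> orient a x y = 0).
  by left; exact: strict_axis_thin ha.
have [hb|/existsNP[y2 /not_implyP[Iy2 n2]]] := pselect (forall y, inner P a b c y -> orient b x y = 0).
  by left; apply: (strict_axis_thin finP S1 (I1 _ Ix)) => y [*]; exact: hb.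
have [hc|/existsNP[y3 /not_implyP[Iy3 n3]]] := pselect (forall y, inner P a b c y -> orient c x y = 0).
  by left; apply: (strict_axis_thin finP S2 (I2 _ Ix)) => y [*]; exact: hc.
have xy1 : x != y1 by apply/eqP => e; apply: n1; rewrite e orientabb.
have xy2 : x != y2 by apply/eqP => e; apply: n2; rewrite e orientabb.
have xy3 : x != y3 by apply/eqP => e; apply: n3; rewrite e orientabb.
right; case: (frame_line nP F Ix Iy1 xy1) => // k1.
  case: (frame_line nP F Ix Iy2 xy2) => // k2.
    exact: (two _ _ _ _ _ S Ix Iy2 Iy1).
  exact: (two _ _ _ _ _ S1 (I1 _ Ix) (I1 _ Iy1) (I1 _ Iy2)).
case: (frame_line nP F Ix Iy3 xy3) => // k3.
  exact: (two _ _ _ _ _ S2 (I2 _ Ix) (I2 _ Iy1) (I2 _ Iy3)).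
exact: (two _ _ _ _ _ S1 (I1 _ Ix) (I1 _ Iy3) (I1 _ Iy1)).
Qed.

Theorem cross_closed_classification P : cross_closed P -> finite_set P -> P !=set0 ->
  thin P \/ sporadic_like P.
Proof.
move=> ccP finP P0; have [h|/existsNP[a /existsNP[b /existsNP[c /existsNP[d /existsNP[o]]]]]] :=
  pselect (cross_free P); first exact: cross_free_classification.
move=> /not_implyP[Pa /not_implyP[Pb /not_implyP[Pc /not_implyP[Pd /contrapT h]]]].
left; exact: cross_thin h.
Qed.

Lemma pinwheel_rot a b c a' b' c' : pinwheel a b c a' b' c' -> pinwheel b c a b' c' a'.
Proof. by case=> *; split=> //; rewrite -orient_rot. Qed.

Lemma pinwheel_sides a b c a' b' c' : pinwheel a b c a' b' c' ->
  [/\ orient b' c' c = 0, 0 < orient b' c' a * orient b' c' a' & orient b' c' a' * orient b' c' b < 0].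
Proof.
case=> -[t [t0 t1 ea]] [s [s0 s1 eb]] [r [r0 r1 ec]] n.
have n' : 0 < orient b' c' a' * orient b' c' a' by rewrite -expr2 exprn_even_gt0 //= -orient_rot.
have Ea := congr1 (orient b' c') ea; have Eb := congr1 (orient b' c') eb; have Ec := congr1 (orient b' c') ec.
rewrite orient_comb2 ?orientaba ?orientabb ?mulr0 ?addr0 in Ea.
rewrite orient_comb2 ?orientaba ?orientabb ?mulr0 ?addr0 in Eb.
rewrite orient_comb2 ?orientaba ?orientabb ?mulr0 ?addr0 in Ec.
split.
- by move/esym/eqP: Ec; rewrite mulf_eq0 gt_eqF /= ?subr_gt0 // => /eqP.
- have -> : orient b' c' a = (1 - t)^-1 * orient b' c' a' by rewrite Ea; field; lra.
  by rewrite -mulrA mulr_gt0 // invr_gt0 subr_gt0.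
- have -> : orient b' c' b = - (s / (1 - s) * orient b' c' a').
    have n1 : 1 - s != 0 by rewrite gt_eqF // subr_gt0.
    by apply: (mulfI n1); transitivity (- (s * orient b' c' a')); [lra|field].
  by rewrite mulrN oppr_lt0 mulrCA mulr_gt0 // divr_gt0 // subr_gt0.
Qed.

(** The line [b'c'] contains [c], has [a] and [a'] on one side and [b] on the other. Dropping [a] or
    [a'] leaves at most one point per side; rotation covers the other deletions. *)
Lemma sub_pinwheel_thin X a b c a' b' c' : finite_set X -> pinwheel a b c a' b' c' ->
  (forall x, X x -> x \in [:: a; b; c; a'; b'; c']) -> ~ X a \/ ~ X a' -> thin X.
Proof.
move=> finX /pinwheel_sides[h1 h2 h3] XS h.
have ab : orient b' c' a * orient b' c' b < 0.
  have n0 : 0 < orient b' c' a' * orient b' c' a'.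
    by rewrite -expr2 exprn_even_gt0 //=; apply: contraTneq h2 => ->; rewrite mulr0 ltxx.
  rewrite -(pmulr_rlt0 _ n0).
  have -> : orient b' c' a' * orient b' c' a' * (orient b' c' a * orient b' c' b) =
    (orient b' c' a * orient b' c' a') * (orient b' c' a' * orient b' c' b) by ring.
  by rewrite pmulr_rlt0.
case: h => h.
- apply: (@thinI _ X b' c' a' b) => // x Xx.
  have := XS x Xx; rewrite !inE => /or4P[| | |/or3P[]] /eqP e.
  + by case: h; rewrite -e.
  + by constructor 3.
  + by constructor 1; rewrite e.
  + by constructor 2.
  + by constructor 1; rewrite e orientaba.
  + by constructor 1; rewrite e orientabb.
- apply: (@thinI _ X b' c' a b) => // x Xx.
  have := XS x Xx; rewrite !inE => /or4P[| | |/or3P[]] /eqP e.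
  + by constructor 2.
  + by constructor 3.
  + by constructor 1; rewrite e.
  + by case: h; rewrite -e.
  + by constructor 1; rewrite e orientaba.
  + by constructor 1; rewrite e orientabb.
Qed.

Lemma sub_sporadic X Y : X `<=` Y -> sporadic_like Y -> thin X \/ sporadic_like X.
Proof.
move=> XY [a [b [c [a' [b' [c' [pw eY]]]]]]].
have finX : finite_set X by apply: sub_finite_set XY _; rewrite eY; exact: finite_seq.
have XS x : X x -> x \in [:: a; b; c; a'; b'; c'] by move/XY; rewrite eY.
have XS1 x : X x -> x \in [:: b; c; a; b'; c'; a'].
  by move/XS; rewrite !inE => /or4P[| | |/or3P[]] ->; rewrite ?orbT.
have XS2 x : X x -> x \in [:: c; a; b; c'; a'; b'].
  by move/XS; rewrite !inE => /or4P[| | |/or3P[]] ->; rewrite ?orbT.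
have pw1 := pinwheel_rot pw; have pw2 := pinwheel_rot pw1.
have [Xa|n] := pselect (X a); last by left; apply: (sub_pinwheel_thin finX pw XS); left.
have [Xa'|n] := pselect (X a'); last by left; apply: (sub_pinwheel_thin finX pw XS); right.
have [Xb|n] := pselect (X b); last by left; apply: (sub_pinwheel_thin finX pw1 XS1); left.
have [Xb'|n] := pselect (X b'); last by left; apply: (sub_pinwheel_thin finX pw1 XS1); right.
have [Xc|n] := pselect (X c); last by left; apply: (sub_pinwheel_thin finX pw2 XS2); left.
have [Xc'|n] := pselect (X c'); last by left; apply: (sub_pinwheel_thin finX pw2 XS2); right.
right; exists a, b, c, a', b', c'; split=> //; rewrite eqEsubset; split=> x; first exact: XS.
by rewrite /= !inE => /or4P[| | |/or3P[]] /eqP->.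
Qed.

(** [cross] demands noncollinearity of one triple only; rotating the quadrilateral derives it for
    the others. *)
Lemma cross_sym a b c d o : cross a b c d o -> cross b c d a o.
Proof.
move=> [h1 h2 n]; split=> //; first exact: btwC.
case: h1 => s [s0 s1 e1]; case: h2 => t [t0 t1 e2].
have : orient a b o = s * orient a b c by rewrite e1 orient_comb2 orientaba mulr0 add0r.
have : orient b c o = (1 - s) * orient b c a by rewrite e1 orient_comb2 orientabb mulr0 addr0.
rewrite {1}e2 orient_comb2 orientaba mulr0 add0r [orient b c a]orient_rot [orient c a b]orient_rot => e3 _.
apply: contra n => /eqP h; rewrite h mulr0 in e3.
have n1 : 1 - s != 0 by rewrite gt_eqF // subr_gt0.
by move/esym/eqP: e3; rewrite mulf_eq0 (negbTE n1).
Qed.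

(** The crossing puts [a] and [c] on opposite sides of the line [bd], whereas the triangle [bcd]
    stays on the side of [c]. *)
Lemma cross_not_tri a b c d o : cross a b c d o -> ~ tri b c d a.
Proof.
move=> h; have [_ _ n] := cross_sym (cross_sym (cross_sym h)).
case: h => -[s [s0 s1 e1]] [t [t0 t1 e2]] _.
have e : (1 - s) * orient b d a + s * orient b d c = 0.
  by rewrite -orient_comb2 -e1 e2 orient_comb2 orientaba orientabb !mulr0 addr0.
case=> x [y [w [x0 y0 w0 hs ea]]].
have ha : orient b d a = y * orient b d c.
  by rewrite {1}ea orient_comb // orientaba orientabb !mulr0 addr0 add0r.
have : ((1 - s) * y + s) * orient b d c = 0 by rewrite -[RHS]e ha; ring.
move/eqP; rewrite mulf_eq0 gt_eqF /=; last first.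
  by rewrite ltr_wpDl // mulr_ge0 // subr_ge0 ltW.
move/eqP => hc; case/eqP: n; rewrite hc mulr0 in ha.
exact: orient0_rot.
Qed.

Lemma cross_convex_position a b c d o x q1 q2 q3 : cross a b c d o ->
  x \in [:: a; b; c; d] -> q1 \in [:: a; b; c; d] -> q2 \in [:: a; b; c; d] ->
  q3 \in [:: a; b; c; d] -> q1 != x -> q2 != x -> q3 != x -> ~ tri q1 q2 q3 x.
Proof.
move=> h.
have key u v w k l : cross u v w k l -> q1 \in [:: u; v; w; k] -> q2 \in [:: u; v; w; k] ->
    q3 \in [:: u; v; w; k] -> q1 != u -> q2 != u -> q3 != u -> ~ tri q1 q2 q3 u.
  move=> h' i1 i2 i3 n1 n2 n3 k'; apply: (cross_not_tri h'); apply: tri_sub k'.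
  - by move: i1; rewrite !inE (negbTE n1) /= => /or3P[] /eqP->; [exact: tri1|exact: tri2|exact: tri3].
  - by move: i2; rewrite !inE (negbTE n2) /= => /or3P[] /eqP->; [exact: tri1|exact: tri2|exact: tri3].
  - by move: i3; rewrite !inE (negbTE n3) /= => /or3P[] /eqP->; [exact: tri1|exact: tri2|exact: tri3].
have rot (u v w k z : 'rV[R]_2) : z \in [:: u; v; w; k] -> z \in [:: v; w; k; u].
  by rewrite !inE => /or4P[] ->; rewrite ?orbT.
have h1 := cross_sym h; have h2 := cross_sym h1; have h3 := cross_sym h2.
rewrite [x \in _]inE => /orP[/eqP->|]; first exact: key h.
rewrite inE => /orP[/eqP->|].
  by move=> i1 i2 i3; apply: key h1 _ _ _; exact: rot.
rewrite inE => /orP[/eqP->|].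
  by move=> i1 i2 i3; apply: key h2 _ _ _; exact/rot/rot.
rewrite inE => /eqP->.
by move=> i1 i2 i3; apply: key h3 _ _ _; exact/rot/rot/rot.
Qed.

Lemma cross_uniq a b c d o : cross a b c d o -> uniq [:: a; b; c; d].
Proof.
have key x y z w k : cross x y z w k -> [/\ x != y, x != z & x != w].
  move=> h; split; apply/eqP => e; apply: (cross_not_tri h); rewrite e.
  - exact: tri1. - exact: tri2. - exact: tri3.
move=> h; have [n1 n2 n3] := key _ _ _ _ _ h.
have [n4 n5 _] := key _ _ _ _ _ (cross_sym h).
have [n6 _ _] := key _ _ _ _ _ (cross_sym (cross_sym h)).
by rewrite /= !inE !negb_or n1 n2 n3 n4 n5 n6.
Qed.

Lemma btw_eql a o b : btw a o b -> a = o -> b = o.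
Proof.
case=> t [t0 _ e] ao; have tn : t != 0 by rewrite gt_eqF.
have ex := congr1 (@px R) e; have ey := congr1 (@py R) e.
by rewrite ao !coordE in ex ey; apply: pt_eq; apply: (mulfI tn); lra.
Qed.

(** The three memberships and their rotations show that no four of the six points are in convex
    position. *)
Lemma pinwheel_facts a b c a' b' c' : pinwheel a b c a' b' c' ->
  [/\ [/\ a' != a, c' != a', c != c' & b != c'], a != c' &
      [/\ tri a c' c' a', tri b c a' c' & tri a b c c']].
Proof.
case=> ba bb bc n.
have n1 : c' != a' by apply: contra_neq n => ->; exact: orientaba.
have n2 : a' != a by apply: contra_neq n1 => e; exact: btw_eql ba _.
have n4 : c != c'.
  by apply: contra_neq n => e; rewrite (btw_eql bc e) orientabb.
case: ba => t [t0 t1 ea]; case: bb => s [s0 s1 eb]; case: bc => r [r0 r1 ec].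
have n5 : b != c'.
  by apply: contra_neq n => <-; rewrite eb /orient !coordE; ring.
have n6 : a != c'.
  apply: contra_neq n1 => e; rewrite ea e; ptring.
split=> //; split.
- by apply: seg_tri12; exists t; split=> //; exact: ltW.
- exists (r * (1 - s)), (1 - r), (r * s); split; try (by rewrite ?mulr_ge0 // ?subr_ge0 ltW); first by ring.
  by rewrite ec eb; ptring.
- apply: (@tri_weights _ (r * s * (1 - t)) (r * (1 - s)) (1 - r)).
  + by rewrite !mulr_ge0 // ?subr_ge0 ltW.
  + by rewrite mulr_ge0 // ?subr_ge0 ltW.
  + by rewrite subr_ge0 ltW.
  + by rewrite ltr_pwDr // ?subr_gt0 // addr_ge0 // !mulr_ge0 // ?subr_ge0 ltW.
  (* Going once around the pinwheel expresses [c'] through itself with weight [r * s * t]; solving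
     leaves total weight [1 - r * s * t]. *)
  + have E : c' = (1 - r) *: c + r *: ((1 - s) *: b + s *: ((1 - t) *: a + t *: c')).
      by rewrite -ea -eb -ec.
    have -> : r * s * (1 - t) + r * (1 - s) + (1 - r) = 1 - r * s * t by ring.
    by rewrite scalerBl scale1r {1}E; ptring.
Qed.

(** The corners of a crossing are four points in convex position; running through all membership
    patterns shows that [S_6] has no such four. *)
Lemma sporadic_cross_free X : sporadic_like X -> cross_free X.
Proof.
case=> a [b [c [a' [b' [c' [pw ->]]]]]] p q r s o /= Lp Lq Lr Ls h.
set L := [:: a; b; c; a'; b'; c'] in Lp Lq Lr Ls.
set Q := [:: p; q; r; s].
have sz : (4 <= count (mem Q) L)%N.
  rewrite -size_filter -[4%N]/(size Q); apply: uniq_leq_size; first exact: cross_uniq h.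
  move=> z Qz; rewrite mem_filter; apply/andP; split; first exact: Qz.
  by move: z Qz; apply/allP; rewrite /Q /= Lp Lq Lr Ls.
have ccp := cross_convex_position h; rewrite -/Q in ccp.
have key x y z x' y' z' : pinwheel x y z x' y' z' ->
    [/\ x \in Q -> x' \in Q -> z' \in Q -> False,
        y \in Q -> z \in Q -> x' \in Q -> z' \in Q -> False &
        x \in Q -> y \in Q -> z \in Q -> z' \in Q -> False].
  move=> /pinwheel_facts[[n1 n2 n3 n4] n5 [t1 t2 t3]]; split=> [i1 i2 i3|i1 i2 i3 i4|i1 i2 i3 i4].
  - by apply: (ccp _ _ _ _ _ _ _ _ _ _ _ t1) => //; rewrite eq_sym.
  - by apply: (ccp _ _ _ _ _ _ _ _ _ _ _ t2) => //; rewrite eq_sym.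
  - by apply: (ccp _ _ _ _ _ _ _ _ _ _ _ t3).
have pw1 := pinwheel_rot pw; have pw2 := pinwheel_rot pw1.
have [A1 A2 A3] := key _ _ _ _ _ _ pw.
have [B1 B2 B3] := key _ _ _ _ _ _ pw1.
have [C1 C2 C3] := key _ _ _ _ _ _ pw2.
move: sz A1 A2 A3 B1 B2 B3 C1 C2 C3; rewrite /L /= -!/(_ \in Q).
case: (a \in Q); case: (b \in Q); case: (c \in Q); case: (a' \in Q);
  case: (b' \in Q); case: (c' \in Q) => //= _; try by auto.
Qed.

(** It suffices to add [s], [s'] and the point [e] where [ss'] meets the axis. If a diagonal lies on
    the axis, the other must be [ss'] and the crossing is [e]. If a diagonal has just one end off
    the axis, the crossing is strictly on that side, while the other diagonal stays in the opposite
    closed half-plane. *)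
Lemma thin_cross_closed X : thin X ->
  exists P, [/\ finite_set P, cross_closed P & X `<=` P].
Proof.
case=> finX [p [q [s [s' [hs hs' hX]]]]].
pose h := orient p q; rewrite -/(h s) in hs; rewrite -/(h s') in hs'.
pose t := h s / (h s - h s').
pose e := (1 - t) *: s + t *: s'.
have d0 : 0 < h s - h s' by lra.
have t0 : 0 < t by rewrite divr_gt0.
have t1 : t < 1 by rewrite ltr_pdivrMr //; lra.
have h2 x y (k : R) : h ((1 - k) *: x + k *: y) = (1 - k) * h x + k * h y by exact: orient_comb2.
have he : h e = 0 by rewrite h2 /t; field; rewrite gt_eqF.
have meet o : btw s o s' -> h o = 0 -> o = e.
  case=> k [k0 k1 ->]; rewrite h2 => hk; suff -> : k = t by [].
  by apply: (mulIf (x := h s - h s')); rewrite ?gt_eqF // /t divfK ?gt_eqF //; lra.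
pose P := X `|` [set s; s'; e].
have finP : finite_set P by rewrite finite_setU; split.
have hP x : P x -> [\/ h x = 0, x = s | x = s'].
  move=> [/hX//|[[]|] ->]; [by constructor 2|by constructor 3|by constructor 1].
exists P; split=> //; last by move=> x Xx; left.
have Pe : P e by right; right.
move=> a b c d o Pa Pb Pc Pd x; have := cross_uniq x.
rewrite /= !inE !negb_or => /and4P[/and3P[ab ac ad] /andP[bc bd] cd _].
have npq : p != q by apply: contraTneq hs => epq; rewrite /h epq orientaab ltxx.
have col u v w : h u = 0 -> h v = 0 -> h w = 0 -> orient u v w = 0 by exact: line_col.
have pos (k u v : R) : 0 < k -> k < 1 -> 0 <= u -> 0 <= v -> 0 < u + v -> 0 < (1 - k) * u + k * v.
  move=> k0 k1 u0 v0 uv; have [u1|u1] := ltP 0 u.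
    by apply: ltr_pwDl; [rewrite mulr_gt0 // subr_gt0|rewrite mulr_ge0 // ltW].
  by apply: ltr_wpDl; [rewrite mulr_ge0 // subr_ge0 ltW|rewrite mulr_gt0 //; lra].
have neg (k u v : R) : 0 < k -> k < 1 -> u <= 0 -> v <= 0 -> u + v < 0 -> (1 - k) * u + k * v < 0.
  move=> k0 k1 u0 v0 uv; have := pos k (- u) (- v) k0 k1; rewrite !oppr_ge0 => /(_ u0 v0).
  by lra.
have zer (k u : R) : 0 < k -> k < 1 -> (1 - k) * 0 + k * u = 0 -> u = 0.
  move=> k0 k1; rewrite mulr0 add0r => /eqP; rewrite mulf_eq0 gt_eqF //= => /eqP//.
have online u v w k z : P v -> P k -> cross u v w k z -> h u = 0 -> h w = 0 -> P z.
  move=> Pv Pk [uw vk n] hu hw.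
  have hz : h z = 0.
    by case: uw => r [_ _ ->]; rewrite h2 hu hw !mulr0 addr0.
  case: (vk) => r [r0 r1 ez]; have hz' := hz; rewrite ez h2 in hz'.
  case: (hP _ Pv) => [hv|ev|ev].
  - by case/eqP: n; apply: col.
  - suff ek : k = s' by rewrite (meet z) // -ek -ev.
    case: (hP _ Pk) => // hk; rewrite ev hk in hz'; exfalso; last by lra.
    have : 0 < (1 - r) * h s by rewrite mulr_gt0 // subr_gt0.
    lra.
  - suff ek : k = s.
      by rewrite (meet z) //; apply: btwC; rewrite -ek -ev.
    case: (hP _ Pk) => // hk; rewrite ev hk in hz'; exfalso; last by lra.
    have : 0 < (1 - r) * - h s' by rewrite mulr_gt0 // ?oppr_gt0 // subr_gt0.
    lra.
case: (x) => -[k [k0 k1 ek]] [l [l0 l1 el]] _.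
have e1 : h o = (1 - k) * h a + k * h c by rewrite ek h2.
have e2 : h o = (1 - l) * h b + l * h d by rewrite el h2.
have bd0 : b <> s -> b <> s' -> d <> s -> d <> s' -> P o.
  move=> b1 b2 d1 d2; apply: (online b c d a) => //; first exact: cross_sym.
    by case: (hP _ Pb).
  by case: (hP _ Pd).
have mixP : 0 <= h a -> 0 <= h c -> 0 < h a + h c -> b <> s -> d <> s -> P o.
  move=> h1 h3 h4 b1 d1; exfalso; have := pos k _ _ k0 k1 h1 h3 h4.
  have hb : h b <= 0 by case: (hP _ Pb) => // ->; rewrite ?lexx // ltW.
  have hd : h d <= 0 by case: (hP _ Pd) => // ->; rewrite ?lexx // ltW.
  have : 0 <= (1 - l) * - h b + l * - h d by rewrite addr_ge0 // mulr_ge0 ?oppr_ge0 // ?subr_ge0 ltW.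
  lra.
have mixN : h a <= 0 -> h c <= 0 -> h a + h c < 0 -> b <> s' -> d <> s' -> P o.
  move=> h1 h3 h4 b1 d1; exfalso; have := neg k _ _ k0 k1 h1 h3 h4.
  have hb : 0 <= h b by case: (hP _ Pb) => // ->; rewrite ?lexx // ltW.
  have hd : 0 <= h d by case: (hP _ Pd) => // ->; rewrite ?lexx // ltW.
  have : 0 <= (1 - l) * h b + l * h d by rewrite addr_ge0 // mulr_ge0 // ?subr_ge0 ltW.
  lra.
move/eqP: ab => ab; move/eqP: ac => ac; move/eqP: ad => ad; move/eqP: bc => bc.
move/eqP: bd => bd; move/eqP: cd => cd.
case: (hP _ Pa) => ha; case: (hP _ Pc) => hc.
- exact: (online a b c d).
- apply: mixP; rewrite ?ha ?hc; try congruence; lra.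
- apply: mixN; rewrite ?ha ?hc; try congruence; lra.
- apply: mixP; rewrite ?ha ?hc; try congruence; lra.
- congruence.
- apply: bd0; congruence.
- apply: mixN; rewrite ?ha ?hc; try congruence; lra.
- apply: bd0; congruence.
- congruence.
Qed.

End Classification.

(** * Configurations *)

Section Configurations.
Context {R : realType}.
Implicit Types (a b c d e o p q r s u x y z w : 'rV[R]_2) (A B P X Y : set 'rV[R]_2).

Lemma card_set_seq (T : eqType) (s : seq T) : uniq s -> [set` s] #= `I_(size s).
Proof.
case: s => [_|x0 s' us]; first by rewrite set_nil /= II0.
set s := x0 :: s' in us *.
have -> : [set` s] = nth x0 s @` `I_(size s).
  rewrite eqEsubset; split=> [x /= xs|x [i /= hi <-]]; last exact: mem_nth.
  have h : (index x s < size s)%N by rewrite index_mem.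
  by exists (index x s) => //; exact: nth_index.
apply: inj_card_eq => i j; rewrite !inE /= => hi hj /eqP.
by rewrite nth_uniq // => /eqP.
Qed.

Lemma card_le_set_seq (T : eqType) n (s : seq T) : `I_n #<= [set` s] -> (n <= size s)%N.
Proof.
have -> : [set` s] = [set` undup s] by rewrite eqEsubset; split=> x; rewrite /= mem_undup.
rewrite (card_le_eqr (card_set_seq (undup_uniq s))) card_le_II => h.
exact: leq_trans h (size_undup s).
Qed.

Lemma line_collinear p u (t : R) : orient p (p + u) (p + t *: u) = 0.
Proof. by rewrite /orient !coordE; ring. Qed.

Lemma line_orient p q (t : R) : orient p q (p + t *: (q - p)) = 0.
Proof. by rewrite /orient !coordE; ring. Qed.

Lemma line_neq p u : u != 0 -> p != p + u.
Proof. by apply: contraNneq => /esym/eqP; rewrite -subr_eq0 addrC addKr. Qed.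

Lemma collinear_orient A x y z : collinear A -> A x -> A y -> A z -> orient x y z = 0.
Proof.
case=> p [u [_ hA]] /hA[r _ <-] /hA[s _ <-] /hA[t _ <-].
by rewrite /orient !coordE; ring.
Qed.

Lemma orient_collinear A p q : p != q -> (forall x, A x -> orient p q x = 0) -> collinear A.
Proof.
move=> pq hA; exists p, (q - p); split; first by rewrite subr_eq0 eq_sym.
by move=> x /hA/(line_param pq)[t ->]; exists t => //; ptring.
Qed.

Lemma segmentE x y : segment x y = seg x y.
Proof.
rewrite /segment eqEsubset; split; last by apply: ch_seg; apply: sub_ch; [left|right].
apply: ch_min; last by move=> z [] ->; [exact: segl|exact: segr].
by apply/convexP => z w t hz hw t0 t1; apply: (@seg_sub _ x y z w) => //; exists t.
Qed.

Lemma chain3 x y z : chain [:: x; y; z] -> btw x y z.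
Proof.
case=> p [u [t [un ts]]]; case: t ts => [|t1 [|t2 [|t3 [|//]]]] //= /and3P[h1 h2 _] [-> -> ->].
exists ((t2 - t1) / (t3 - t1)); split.
- by apply: divr_gt0; lra.
- by rewrite ltr_pdivrMr; lra.
- by apply: pt_eq; rewrite !coordE; field; lra.
Qed.

Lemma btw_chain x y z : x != z -> btw x y z -> chain [:: x; y; z].
Proof.
move=> xz [t [t0 t1 e]]; exists x, (z - x), [:: 0; t; 1]; split.
- by rewrite subr_eq0 eq_sym.
- by rewrite /= t0 t1.
- by rewrite e /=; congr [:: _; _; _]; ptring.
Qed.

Lemma linear_thin n Y : linear_configuration n Y -> thin Y.
Proof.
case=> _ cY [p [u [un hY]]]; apply: (@collinear_thin _ Y p (p + u)).
- by exists n.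
- exact: line_neq.
- by move=> x /hY[t _ <-]; exact: line_collinear.
Qed.

Lemma triangular_thin n Y : triangular_configuration n Y -> thin Y.
Proof.
case=> _ [a [s [_ [p [u [t [un _ ->]]]] _ ->]]]; apply: (@thin1 _ _ p (p + u) s) => //.
  exact: line_neq.
move=> x /=; rewrite inE => /orP[/eqP->|/mapP[r _ ->]]; first by right.
by left; exact: line_collinear.
Qed.

(** The centre is on the axis and [s], [s'] are not, so it lies strictly between them and they are
    on opposite sides. *)
Lemma diamond_thin m n Y c : diamond_with_centre m n Y c -> thin Y.
Proof.
case=> _ [a [b [s [s' [_ [p0 [u [t [un _ e]]]] [ss nc nc'] hc ->]]]]].
have pn := line_neq p0 un.
have line x : x \in a ++ c :: b -> orient p0 (p0 + u) x = 0.
  by rewrite e => /mapP[r _ ->]; exact: line_collinear.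
have off z : ~ collinear [set` z :: a ++ c :: b] -> orient p0 (p0 + u) z != 0.
  move=> h; apply/eqP => hz; apply: h; apply: (orient_collinear pn) => x /=.
  by rewrite inE => /orP[/eqP->|/line].
have n1 := off _ nc; have n2 := off _ nc'.
have hc0 : orient p0 (p0 + u) c = 0 by apply: line; rewrite mem_cat mem_head orbT.
have : seg s s' c by rewrite -segmentE; have : [set c] c by []; rewrite -hc => -[].
case/seg_cases => [ec|ec|[k [k0 k1 ec]]].
- by rewrite -ec hc0 eqxx in n1.
- by rewrite -ec hc0 eqxx in n2.
apply: (@thinI _ _ p0 (p0 + u) s s') => //.
  rewrite ec orient_comb2 in hc0.
  have E : orient p0 (p0 + u) s = - (k / (1 - k)) * orient p0 (p0 + u) s'.
    have kn : 1 - k != 0 by rewrite gt_eqF // subr_gt0.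
    by apply: (mulfI kn); transitivity (- (k * orient p0 (p0 + u) s')); [lra|field].
  rewrite E -mulrA mulNr oppr_lt0 mulr_gt0 // ?divr_gt0 ?subr_gt0 //.
  by rewrite -expr2 exprn_even_gt0.
move=> x /=; rewrite !inE => /or3P[/eqP->|/eqP->|/line]; [by constructor 2|by constructor 3|by constructor 1].
Qed.

(** If [a'], [b'], [c'] were collinear they would be one of the three permitted lines, but each of
    those contains [a], [b] or [c]. *)
Lemma sporadic_sporadic_like Y : sporadic_configuration Y -> sporadic_like Y.
Proof.
case=> a [b [c [a' [b' [c' [un eY [h1 h2 h3] h]]]]]].
exists a, b, c, a', b', c'; split=> //; split; try exact: chain3.
apply/eqP => hc.
have [ab' ac' bc'] : [/\ a' != b', a' != c' & b' != c'].
  by move: un; rewrite /= !inE !negb_or => /and5P[_ _ _ /andP[-> ->] /andP[-> _]].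
have un3 : uniq [:: a'; b'; c'] by rewrite /= !inE !negb_or ab' ac' bc'.
have sub : [set` [:: a'; b'; c']] `<=` Y.
  by rewrite eY => x /=; rewrite !inE => /or3P[] ->; rewrite ?orbT.
have col : collinear [set` [:: a'; b'; c']].
  apply: (orient_collinear ab') => x /=; rewrite !inE => /or3P[] /eqP->.
  - exact: orientaba. - exact: orientabb. - exact: hc.
have le3 : `I_3 #<= [set` [:: a'; b'; c']] by rewrite (card_le_eqr (card_set_seq un3)) card_lexx.
move: un; rewrite /= !inE !negb_or => /and5P[na nb nc _ _].
case: (h _ sub le3 col) => e.
- have : [set` [:: a'; b'; c']] a by rewrite e /= mem_head.
  rewrite /= !inE; move: na => /and5P[_ _ /negbTE-> /negbTE-> /negbTE->]; by [].
- have : [set` [:: a'; b'; c']] b by rewrite e /= mem_head.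
  rewrite /= !inE; move: nb => /and4P[_ /negbTE-> /negbTE-> /negbTE->]; by [].
- have : [set` [:: a'; b'; c']] c by rewrite e /= mem_head.
  rewrite /= !inE; move: nc => /and3P[/negbTE-> /negbTE-> /negbTE->]; by [].
Qed.

(** Together with [a' b' c'] and the rotations these are 17 of the 20 triples, all but the three
    lines of [S_6]. Most areas are compared with that of [a b c']; the relation for [a b c] goes
    once around the pinwheel, whence the factor [1 - r * s * t]. *)
Lemma pinwheel_noncollinear a b c a' b' c' : pinwheel a b c a' b' c' ->
  [/\ orient a b c != 0, [/\ orient a b a' != 0, orient a b b' != 0 & orient a b c' != 0],
      orient a a' b' != 0 & orient a b' c' != 0].
Proof.
move=> pw; have [_ h2 _] := pinwheel_sides pw.
have [_ _ h3] := pinwheel_sides (pinwheel_rot (pinwheel_rot pw)).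
case: pw => -[t [t0 t1 ea]] [s [s0 s1 eb]] [r [r0 r1 ec]] n.
have t2 : 1 - t != 0 by rewrite gt_eqF // subr_gt0.
have s2 : 1 - s != 0 by rewrite gt_eqF // subr_gt0.
have tn : t != 0 by rewrite gt_eqF.
have sn : s != 0 by rewrite gt_eqF.
have rn : r != 0 by rewrite gt_eqF.
have E1 : orient a' b' c' = (1 - s) * (1 - t) * orient a b c'.
  rewrite -mulrA; transitivity ((1 - s) * orient a' b c').
    by rewrite eb /orient !coordE; ring.
  by congr (_ * _); rewrite ea /orient !coordE; ring.
have n1 : orient a b c' != 0 by apply: contra n; rewrite E1 => /eqP->; rewrite mulr0.
have E2 : orient a b a' = t * orient a b c' by rewrite ea orient_comb2 orientaba mulr0 add0r.
have n2 : orient a b a' != 0 by rewrite E2 mulf_neq0.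
have E3 : orient a b b' = s * orient a b a' by rewrite eb orient_comb2 orientabb mulr0 add0r.
have n3 : orient a b b' != 0 by rewrite E3 mulf_neq0.
have E4 : (1 - r) * orient a b c = (1 - r * s * t) * orient a b c'.
  have : orient a b c' = (1 - r) * orient a b c + r * orient a b b' by rewrite {1}ec orient_comb2.
  by rewrite E3 E2 => e; lra.
split.
- apply: contra n1 => /eqP h; move/eqP: E4; rewrite h mulr0 eq_sym mulf_eq0 => /orP[/eqP k|//].
  have : r * s * t < 1.
    by rewrite -[1]mulr1; apply: ltr_pM; rewrite ?mulr_ge0 ?ltW // -[1]mulr1 ltr_pM // ltW.
  by rewrite (_ : r * s * t = 1) ?ltxx //; lra.
- by split.
- apply: contraTneq h3 => h; rewrite (_ : orient a' b' a = 0) ?mulr0 ?mul0r ?ltxx //.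
  exact: orient0_rot.
- by apply: contraTneq h2 => h; rewrite (orient0_rot h) mul0r ltxx.
Qed.

End Configurations.

(** * From thin sets and pinwheels to the named configurations *)

Section Recognition.
Context {R : realType}.
Implicit Types (a b c d e o p q r s u x y z w : 'rV[R]_2) (A B P X Y : set 'rV[R]_2).

Lemma orient_neq a b c : orient a b c != 0 -> [/\ a != b, b != c & a != c].
Proof.
by move=> h; split; apply: contra_neq h => ->; rewrite ?orientaab ?orientabb ?orientaba.
Qed.

Lemma set_seq_filter (T : eqType) (A : set T) (l : seq T) : A `<=` [set` l] ->
  A = [set` [seq z <- l | z \in A]].
Proof.
move=> Al; rewrite eqEsubset; split=> x /=; rewrite mem_filter; last by case/andP => /set_mem.
by move=> Ax; apply/andP; split; [exact: mem_set|exact: Al].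
Qed.

Lemma sporadic_like_sporadic Y : sporadic_like Y -> sporadic_configuration Y.
Proof.
case=> a [b [c [a' [b' [c' [pw eY]]]]]]; exists a, b, c, a', b', c'.
have [m1 [m2 m3 m4] m5 m6] := pinwheel_noncollinear pw.
have [k1 [k2 k3 k4] k5 k6] := pinwheel_noncollinear (pinwheel_rot pw).
have [l1 [l2 l3 l4] l5 l6] := pinwheel_noncollinear (pinwheel_rot (pinwheel_rot pw)).
have [ha hb hc n] := pw.
have [ab bc ac] := orient_neq m1; have [ab' bc' ac'] := orient_neq n.
have [_ ba' aa'] := orient_neq m2; have [_ cb' bb'] := orient_neq k2; have [_ ac'' cc'] := orient_neq l2.
have [_ _ ab''] := orient_neq m3; have [_ _ bc''] := orient_neq k3; have [_ _ ca''] := orient_neq l3.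
set L := [:: a; b; c; a'; b'; c'] in eY *.
have uL : uniq L.
  by rewrite /L /= !inE !negb_or ab ac aa' ab'' ac'' bc ba' bb' bc'' ca'' cb' cc' ab' ac' bc'.
split=> //; first by split; exact: btw_chain.
move=> A AY A3 colA.
have EA : A = [set` [seq z <- L | z \in A]] by apply: set_seq_filter; rewrite -eY.
have sz : (3 <= count (fun z => z \in A) L)%N.
  by rewrite -size_filter; apply: card_le_set_seq; rewrite -EA.
have key x y z : orient x y z != 0 -> x \in A -> y \in A -> z \in A -> False.
  by rewrite !in_setE => /eqP h hx hy hz; apply: h; exact: collinear_orient colA hx hy hz.
have {}n := key _ _ _ n.
have {}m1 := key _ _ _ m1; have {}m2 := key _ _ _ m2; have {}m3 := key _ _ _ m3.
have {}m4 := key _ _ _ m4; have {}m5 := key _ _ _ m5; have {}m6 := key _ _ _ m6.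
have {}k2 := key _ _ _ k2; have {}k3 := key _ _ _ k3; have {}k4 := key _ _ _ k4.
have {}k5 := key _ _ _ k5; have {}k6 := key _ _ _ k6.
have {}l2 := key _ _ _ l2; have {}l3 := key _ _ _ l3; have {}l4 := key _ _ _ l4.
have {}l5 := key _ _ _ l5; have {}l6 := key _ _ _ l6.
have -> : [set` [:: b; b'; a']] = [set` [:: b; a'; b']].
  by rewrite eqEsubset; split=> x /=; rewrite !inE => /or3P[] ->; rewrite ?orbT.
have -> : [set` [:: c; c'; b']] = [set` [:: c; b'; c']].
  by rewrite eqEsubset; split=> x /=; rewrite !inE => /or3P[] ->; rewrite ?orbT.
rewrite {}EA; move: sz n m1 m2 m3 m4 m5 m6 k2 k3 k4 k5 k6 l2 l3 l4 l5 l6; rewrite /L /=; clear.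
case: (a \in A); case: (b \in A); case: (c \in A); case: (a' \in A);
  case: (b' \in A); case: (c' \in A) => //= _ n m1 m2 m3 m4 m5 m6 k2 k3 k4 k5 k6 l2 l3 l4 l5 l6;
  first [by constructor 1 | by constructor 2 | by constructor 3 | by exfalso; auto].
Qed.

Lemma line_enum X p u : finite_set X -> u != 0 ->
  exists ts : seq R, sorted <%R ts /\ forall t, X (p + t *: u) <-> t \in ts.
Proof.
move=> finX un.
have : finite_set [set t : R | X (p + t *: u)].
  apply: finite_preimage finX => t t' _ _ /addrI/eqP.
  by rewrite -subr_eq0 -scalerBl scaler_eq0 (negbTE un) orbF subr_eq0 => /eqP.
case/finite_seqP => l e; exists (sort <=%R (undup l)); split.
  by rewrite sort_lt_sorted undup_uniq.
move=> t; rewrite mem_sort mem_undup.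
by have -> : X (p + t *: u) = [set t : R | X (p + t *: u)] t by []; rewrite e.
Qed.

Lemma collinear_configuration X : finite_set X -> X !=set0 -> collinear X ->
  exists n, linear_configuration n X.
Proof.
move=> [n Xn] X0 cX; exists n; split=> //; rewrite lt0n; apply/eqP => n0.
by move: X0 Xn; rewrite n0 II0 card_eq0 -set0P => /negbTE->.
Qed.

Lemma triangular_recognition X p q z : finite_set X -> X z -> orient p q z != 0 ->
  (forall x, X x -> orient p q x = 0 \/ x = z) ->
  (exists n, linear_configuration n X) \/ exists n, triangular_configuration n X.
Proof.
move=> finX Xz nz hX; have [pq _ _] := orient_neq nz.
have un : q - p != 0 by rewrite subr_eq0 eq_sym.
have [ts [sts hts]] := line_enum p finX un.
have eX : X = [set` z :: [seq p + t *: (q - p) | t <- ts]].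
  rewrite eqEsubset; split=> x /=; rewrite inE.
    move=> Xx; case: (hX _ Xx) => [/(line_param pq)[t et]|->]; last by rewrite eqxx.
    apply/orP; right; apply/mapP; exists t; last by rewrite et; ptring.
    by apply/hts; suff -> : p + t *: (q - p) = x by []; rewrite et; ptring.
  by move=> /orP[/eqP->//|/mapP[t /hts ? ->]].
(* [T_n] needs two axis points; with none or one, [X] has at most two points and is linear. *)
case: ts sts hts eX => [|t1 [|t2 ts]] sts hts eX.
- left; apply: collinear_configuration => //; first by exists z.
  exists z, (q - p); split=> // x; rewrite eX /= inE => /eqP->; exists 0 => //.
  by rewrite scale0r addr0.
- left; apply: collinear_configuration => //; first by exists z.
  apply: (@orient_collinear _ _ z (p + t1 *: (q - p))).
    by apply/eqP => e; move/eqP: nz; rewrite e line_orient.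
  by move=> x; rewrite eX /= !inE => /orP[] /eqP->; [exact: orientaba|exact: orientabb].
right; exists (size [:: t1, t2 & ts]); split=> //.
exists [seq p + t *: (q - p) | t <- [:: t1, t2 & ts]], z; split=> //.
- by rewrite size_map.
- by exists p, (q - p), [:: t1, t2 & ts].
- move=> cX; move/eqP: nz; apply.
  have : orient (p + t1 *: (q - p)) (p + t2 *: (q - p)) z = 0.
    by apply: (collinear_orient cX); rewrite /= !inE eqxx ?orbT.
  have -> : orient (p + t1 *: (q - p)) (p + t2 *: (q - p)) z = (t2 - t1) * orient p q z.
    by rewrite /orient !coordE; ring.
  move/eqP; rewrite mulf_eq0 => /orP[|/eqP//].
  by move: sts => /= /andP[h _]; rewrite subr_eq0 gt_eqF.
Qed.

(** The strict filters drop [t] before it is put back, so the centre may or may not occur in [ts].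
    This covers diamonds and subdiamonds together. *)
Lemma sorted_split (ts : seq R) (t : R) : sorted <%R ts ->
  sorted <%R ([seq x <- ts | x < t] ++ t :: [seq x <- ts | t < x]).
Proof.
move=> h; rewrite (sorted_pairwise lt_trans) pairwise_cat; apply/and3P; split.
- apply/allrelP => x y; rewrite mem_filter inE => /andP[xt _] /orP[/eqP->//|].
  by rewrite mem_filter => /andP[ty _]; exact: lt_trans ty.
- by rewrite -(sorted_pairwise lt_trans); apply: sorted_filter => //; exact: lt_trans.
- rewrite /=; apply/andP; split; first by apply/allP => x; rewrite mem_filter => /andP[].
  by rewrite -(sorted_pairwise lt_trans); apply: sorted_filter => //; exact: lt_trans.
Qed.

(** When [s] and [s'] both belong to [X], the centre [c] is the point of [ss'] on the axis, and [D]
    or [I] is obtained according to whether [c] belongs to [X]. Otherwise at most one point is off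
    the axis. *)
Lemma thin_configuration X : X !=set0 -> thin X ->
  [\/ exists n, linear_configuration n X,
      exists n, triangular_configuration n X |
      exists m n, diamond_configuration m n X \/ subdiamond_configuration m n X].
Proof.
move=> X0 [finX [p [q [s [s' [hs hs' hX]]]]]].
have ns : orient p q s != 0 by rewrite gt_eqF.
have ns' : orient p q s' != 0 by rewrite lt_eqF.
have tri_case z : X z -> orient p q z != 0 -> (forall x, X x -> orient p q x = 0 \/ x = z) ->
  [\/ exists n, linear_configuration n X,
      exists n, triangular_configuration n X |
      exists m n, diamond_configuration m n X \/ subdiamond_configuration m n X].
  by move=> Xz nz h; case: (triangular_recognition finX Xz nz h) => ?; [constructor 1|constructor 2].
have [pq _ _] := orient_neq ns.
have [Xs|nXs] := pselect (X s); last first.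
  have [Xs'|nXs'] := pselect (X s').
    apply: (tri_case s') => // x Xx; case: (hX _ Xx) => [?|e|?]; [by left| |by right].
    by case: nXs; rewrite -e.
  constructor 1; apply: collinear_configuration => //; apply: (orient_collinear pq) => x Xx.
  by case: (hX _ Xx) => // e; [case: nXs|case: nXs']; rewrite -e.
have [Xs'|nXs'] := pselect (X s'); last first.
  apply: (tri_case s) => // x Xx; case: (hX _ Xx) => [?|?|e]; [by left|by right|].
  by case: nXs'; rewrite -e.
have ss : s != s' by apply: contraTneq hs => ->; rewrite lt_gtF.
pose k := orient p q s / (orient p q s - orient p q s').
have d0 : 0 < orient p q s - orient p q s' by lra.
have k0 : 0 < k by rewrite divr_gt0.
have k1 : k < 1 by rewrite ltr_pdivrMr //; lra.
pose c := (1 - k) *: s + k *: s'.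
have hc : orient p q c = 0 by rewrite orient_comb2 /k; field; rewrite gt_eqF.
have meet z : (exists t, z = (1 - t) *: s + t *: s') -> orient p q z = 0 -> z = c.
  case=> t ->; rewrite orient_comb2 => ht; suff -> : t = k by [].
  by apply: (mulIf (x := orient p q s - orient p q s')); rewrite ?gt_eqF // /k divfK ?gt_eqF //; lra.
have un : q - p != 0 by rewrite subr_eq0 eq_sym.
have [ts [sts hts]] := line_enum p finX un.
pose L t := p + t *: (q - p).
have LE t : L t = lineat p q t by rewrite /L /lineat; ptring.
have Linj t t' : L t = L t' -> t = t'.
  move/addrI/eqP; rewrite -subr_eq0 -scalerBl scaler_eq0 (negbTE un) orbF subr_eq0.
  by move/eqP.
have [tc ec] : exists tc, c = L tc.
  by have [t et] := line_param pq hc; exists t; rewrite et LE.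
have hL t : orient p q (L t) = 0 by exact: line_orient.
pose ta := [seq x <- ts | x < tc]; pose tb := [seq x <- ts | tc < x].
have srt : sorted <%R (ta ++ tc :: tb) by exact: sorted_split.
have onaxis t : X (L t) <-> t \in ts by exact: hts.
have split_ts t : t \in ts -> [\/ t \in ta, t = tc | t \in tb].
  move=> tin; case: (ltgtP t tc) => h; [constructor 1|constructor 3|by constructor 2].
    by rewrite mem_filter h. by rewrite mem_filter h.
have sub_a t : t \in ta -> X (L t) by rewrite mem_filter => /andP[_ /onaxis].
have sub_b t : t \in tb -> X (L t) by rewrite mem_filter => /andP[_ /onaxis].
have XE x : X x <-> [\/ x = s, x = s' | exists2 t, x = L t & t \in ts].
  split.
    move=> Xx; case: (hX _ Xx) => [/(line_param pq)[t et]|->|->]; [|by constructor 1|by constructor 2].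
    constructor 3; exists t; first by rewrite LE.
    by apply/onaxis; rewrite LE /lineat -et.
  by case=> [->|->|[t -> /onaxis]].
have [hpq|hpq] := boolP ((size ta, size tb) \in [:: (0, 0); (1, 0); (0, 1)]%N); last first.
  pose D := [set` s :: s' :: map L ta ++ c :: map L tb].
  have eD : map L ta ++ c :: map L tb = map L (ta ++ tc :: tb) by rewrite map_cat /= ec.
  have dD : diamond_with_centre (size ta) (size tb) D c.
    split=> //; exists (map L ta), (map L tb), s, s'; split=> //.
    - by rewrite !size_map.
    - by exists p, (q - p), (ta ++ tc :: tb).
    - have [t [tin ttc]] : exists t, t \in ta ++ tc :: tb /\ t <> tc.
        case eta : ta hpq => [|t ta']; last first.
          exists t; rewrite mem_head; split=> //.
          have : t \in ta by rewrite eta mem_head.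
          by rewrite mem_filter => /andP[h _] e; rewrite e ltxx in h.
        case etb : tb => [|t tb'] // _; exists t; rewrite !inE eqxx orbT; split=> //.
        have : t \in tb by rewrite etb mem_head.
        by rewrite mem_filter => /andP[h _] e; rewrite e ltxx in h.
      have off z : orient p q z != 0 -> ~ collinear [set` z :: map L ta ++ c :: map L tb].
        rewrite eD => nz cz; have : orient (L t) (L tc) z = 0.
          apply: (collinear_orient cz); rewrite /= inE ?eqxx // map_f ?orbT //.
          by rewrite mem_cat mem_head orbT.
        have -> : orient (L t) (L tc) z = (tc - t) * orient p q z.
          by rewrite /L /orient !coordE; ring.
        move/eqP; rewrite mulf_eq0 (negbTE nz) orbF subr_eq0 => /eqP e.
        exact: ttc.
      by split=> //; exact: off.
    - rewrite !segmentE eqEsubset; split.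
        move=> z [[t [_ _ ez]] [r [_ _ ez']]] /=; apply: meet; first by exists t.
        have hd : orient p q (head c (map L ta)) = 0 by case: (ta) => [|t1 l1]; [exact: hc|exact: hL].
        have la : orient p q (last c (map L tb)) = 0.
          by rewrite ec last_map.
        by rewrite ez' orient_comb2 hd la !mulr0 addr0.
      move=> _ ->; split; first by exists k; split=> //; exact: ltW.
      have -> : head c (map L ta) = L (head tc ta) by rewrite ec; case: (ta).
      rewrite ec last_map !LE; apply: seg_lineat.
        case eta : ta => [|t ta'] //=; have : t \in ta by rewrite eta mem_head.
        by rewrite mem_filter => /andP[/ltW].
      have := mem_last tc tb; rewrite inE => /orP[/eqP->//|].
      by rewrite mem_filter => /andP[/ltW].
  have XD x : x <> c -> (X x <-> D x).
    move=> xc; rewrite XE /D /= eD !inE; split.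
      case=> [->|->|[t et /split_ts tin]]; rewrite ?eqxx ?orbT //.
      apply/orP; right; apply/orP; right; rewrite et map_f // mem_cat inE.
      by case: tin => h; [rewrite h|rewrite h eqxx orbT|rewrite h !orbT].
    move=> /or3P[/eqP->|/eqP->|/mapP[t]]; [by constructor 1|by constructor 2|].
    rewrite mem_cat inE => tin et; constructor 3; exists t => //; apply/onaxis.
    case/or3P: tin => [/sub_a//|/eqP h|/sub_b//].
    by case: xc; rewrite et h ec.
  constructor 3; exists (size ta), (size tb).
  have Dc : D c by rewrite /D /= eD ec !inE map_f ?orbT // mem_cat mem_head orbT.
  have [Xc|nXc] := pselect (X c).
    left; exists c; suff -> : X = D by [].
    rewrite eqEsubset; split=> x; have [->//|/eqP xc] := eqVneq x c; by move/(XD _ xc).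
  right; exists D, c; split=> //; rewrite eqEsubset; split=> x.
    move=> Xx; have xc : x <> c by move=> e; apply: nXc; rewrite -e.
    by split=> //; apply/XD.
  by case=> Dx xc; apply/XD.
(* For the excluded parameters at most one axis point differs from [c]. All the rest lies on the
   line [ss'], which becomes the axis of a linear or triangular configuration. *)
have colss x : x = s \/ x = s' \/ x = c -> orient s s' x = 0.
  case=> [->|[->|->]]; [exact: orientaba|exact: orientabb|].
  by rewrite orient_comb2 orientaba orientabb !mulr0 addr0.
have dich : (forall t, t \in ts -> t = tc) \/
    exists t1, [/\ t1 \in ts, t1 <> tc & forall t, t \in ts -> t = tc \/ t = t1].
  have inta t : t \in ta -> t \in ts /\ t <> tc.
    by rewrite mem_filter => /andP[h ?]; split=> // e; rewrite e ltxx in h.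
  have intb t : t \in tb -> t \in ts /\ t <> tc.
    by rewrite mem_filter => /andP[h ?]; split=> // e; rewrite e ltxx in h.
  move: hpq; rewrite !inE !xpair_eqE => /or3P[] /andP[ha hb].
  - left=> t /split_ts[|//|]; first by move/nilP: ha => ->.
    by move/nilP: hb => ->.
  - right; case eta: ta ha => [|t1 [|//]] // _; exists t1.
    have [t1s t1c] := inta t1 (eq_ind_r (fun l => t1 \in l) (mem_head _ _) eta).
    split=> // t /split_ts[|->|]; [|by left|by move/nilP: hb => ->].
    by rewrite eta inE => /eqP; right.
  - right; case etb: tb hb => [|t1 [|//]] // _; exists t1.
    have [t1s t1c] := intb t1 (eq_ind_r (fun l => t1 \in l) (mem_head _ _) etb).
    split=> // t /split_ts[|->|]; [by move/nilP: ha => ->|by left|].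
    by rewrite etb inE => /eqP; right.
case: dich => [h|[t1 [t1s t1c h]]].
  constructor 1; apply: collinear_configuration => //; apply: (orient_collinear ss) => x.
  move/XE => [->|->|[t -> /h->]]; apply: colss; [by left|by right; left|by right; right].
have nw : orient s s' (L t1) != 0.
  apply/eqP => /(line_param ss)[t et]; apply: t1c; apply: Linj; rewrite -ec.
  by apply: meet; [exists t|exact: hL].
have Xw : X (L t1) by apply/onaxis.
have [] := triangular_recognition finX Xw nw; [|by constructor 1|by constructor 2].
move=> x /XE[->|->|[t -> /h[->|->]]]; [left|left|left|by right]; apply: colss.
- by left. - by right; left. - by right; right.
Qed.

Lemma configuration_thin X :
  [\/ exists n, linear_configuration n X,
      exists n, triangular_configuration n X,
      exists m n, diamond_configuration m n X \/ subdiamond_configuration m n X |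
      sporadic_configuration X] -> thin X \/ sporadic_like X.
Proof.
case=> [[n h]|[n h]|[m [n [[c h]|[D [c [h ->]]]]]]|h].
- left; exact: linear_thin h.
- left; exact: triangular_thin h.
- left; exact: diamond_thin h.
- left; apply: thin_sub (diamond_thin h); exact: subDsetl.
- right; exact: sporadic_sporadic_like.
Qed.

(** For distinct points, one of the lines [ab], [ac], [ad] weakly separates the other two: the
    product of the three separation products is minus a square, so they are not all positive. *)
Lemma four_points_thin X a b c d : (forall x, X x -> x \in [:: a; b; c; d]) -> thin X.
Proof.
move=> hX; have finX : finite_set X by apply: sub_finite_set (finite_seq [:: a; b; c; d]).
have three u v w : (forall x, X x -> [\/ x = u, x = v | x = w]) -> thin X.
  move=> h; have two y z : (forall x, X x -> x = y \/ x = z) -> thin X.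
    move=> h'; have [e|yz] := eqVneq y z; last first.
      by apply: (collinear_thin finX yz) => x /h'[->|->]; [exact: orientaba|exact: orientabb].
    apply: (@collinear_thin _ _ y (y + const_mx 1)) => //.
      by apply: line_neq; apply/eqP => /(congr1 (@px R)); rewrite /px !mxE; apply/eqP; rewrite oner_eq0.
    by move=> x /h'[->|->]; rewrite -?e orientaba.
  have [e|uv] := eqVneq u v.
    by apply: (two u w) => x /h[->|->|->]; [left|left|right].
  by apply: (@thin1 _ _ u v w) => // x /h[->|->|->]; [left; exact: orientaba|left; exact: orientabb|right].
have four x : X x -> [\/ x = a, x = b, x = c | x = d].
  by move/hX; rewrite !inE => /or4P[] /eqP; [constructor 1|constructor 2|constructor 3|constructor 4].
have [e|ab] := eqVneq a b.
  by apply: (three b c d) => x /four[->|->|->|->]; rewrite ?e; [constructor 1|constructor 1|constructor 2|constructor 3].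
have [e|ac] := eqVneq a c.
  by apply: (three b c d) => x /four[->|->|->|->]; rewrite ?e; [constructor 2|constructor 1|constructor 2|constructor 3].
have [e|ad] := eqVneq a d.
  by apply: (three b c d) => x /four[->|->|->|->]; rewrite ?e; [constructor 3|constructor 1|constructor 2|constructor 3].
have line y z w : a != y -> orient a y z * orient a y w <= 0 ->
    (forall x, X x -> [\/ x = a, x = y, x = z | x = w]) -> thin X.
  move=> ay; rewrite le_eqVlt => /orP[h0|h] hx; last first.
    apply: (@thinI _ _ a y z w) => // x /hx[->|->|->|->].
    - constructor 1; exact: orientaba. - constructor 1; exact: orientabb.
    - by constructor 2. - by constructor 3.
  move: h0; rewrite mulf_eq0 => /orP[/eqP h|/eqP h].
    apply: (@thin1 _ _ a y w) => // x /hx[->|->|->|->].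
    - left; exact: orientaba. - left; exact: orientabb. - by left. - by right.
  apply: (@thin1 _ _ a y z) => // x /hx[->|->|->|->].
  - left; exact: orientaba. - left; exact: orientabb. - by right. - by left.
have [h1|h1] := leP (orient a b c * orient a b d) 0; first exact: (line b c d).
have [h2|h2] := leP (orient a c b * orient a c d) 0.
  by apply: (line c b d) => // x /four[]; [constructor 1|constructor 3|constructor 2|constructor 4].
have [h3|h3] := leP (orient a d b * orient a d c) 0.
  by apply: (line d b c) => // x /four[]; [constructor 1|constructor 3|constructor 4|constructor 2].
have := mulr_gt0 (mulr_gt0 h1 h2) h3.
have -> : orient a b c * orient a b d * (orient a c b * orient a c d) * (orient a d b * orient a d c) =
   - (orient a b c * orient a b d * orient a c d) ^+ 2 by rewrite /orient; ring.
by rewrite oppr_gt0 ltNge sqr_ge0.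
Qed.

End Recognition.

(** * Equivalence *)

Section Equivalence.
Context {R : realType}.
Implicit Types (a b c d e o p q r s u x y z w : 'rV[R]_2) (A B P X Y : set 'rV[R]_2).
Implicit Types (f : 'rV[R]_2 -> 'rV[R]_2).

Definition preserves_hulls f X Y :=
  set_bij X Y f /\ forall A, A `<=` X -> f @` Rch X A = Rch Y (f @` A).

Lemma triE a b c : ch [set a; b; c] = tri a b c.
Proof.
rewrite eqEsubset; split; last first.
  by apply: ch_tri; apply: sub_ch; [left; left|left; right|right].
apply: ch_min; last by move=> x [[->|->]|->]; [exact: tri1|exact: tri2|exact: tri3].
apply/convexP => x y t hx hy t0 t1; apply: (tri_sub hx hx hy); apply: seg_tri.
by exists t.
Qed.

Lemma seg_orient a b c : seg a b c -> orient a b c = 0.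
Proof.
by case=> t [_ _ ->]; rewrite orient_comb2 orientaba orientabb !mulr0 addr0.
Qed.

Lemma preserves_hulls_tri f X Y x y z w : preserves_hulls f X Y -> X x -> X y -> X z -> X w ->
  tri x y z w <-> tri (f x) (f y) (f z) (f w).
Proof.
case=> -[ff finj _] h Xx Xy Xz Xw.
have AX : [set x; y; z] `<=` X by move=> u [[->|->]|->].
have eA : f @` [set x; y; z] = [set f x; f y; f z] by rewrite !image_setU !image_set1.
rewrite -!triE -eA; split=> hw.
  have : (f @` Rch X [set x; y; z]) (f w) by exists w.
  by rewrite h // => -[].
have : (Rch Y (f @` [set x; y; z])) (f w) by split=> //; exact: ff.
rewrite -h // => -[w' [Aw' Xw'] e].
by have <- : w' = w by apply: finj; rewrite ?in_setE.
Qed.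

Lemma preserves_hulls_seg f X Y x y z : preserves_hulls f X Y -> X x -> X y -> X z ->
  seg x y z <-> seg (f x) (f y) (f z).
Proof.
move=> F Xx Xy Xz; have := preserves_hulls_tri F Xx Xx Xy Xz.
by move=> [h1 h2]; split=> /seg_tri h; apply: tri_seg; [exact: h1|exact: h2].
Qed.

Lemma preserves_hulls_col f X Y x y z : preserves_hulls f X Y -> X x -> X y -> X z ->
  orient (f x) (f y) (f z) = 0 <-> orient x y z = 0.
Proof.
move=> F Xx Xy Xz; split=> /col_seg[] h.
- exact: seg_orient (proj2 (preserves_hulls_seg F Xx Xy Xz) h).
- by do 2!apply: orient0_rot; exact: seg_orient (proj2 (preserves_hulls_seg F Xy Xz Xx) h).
- exact: orient0_swapr (seg_orient (proj2 (preserves_hulls_seg F Xx Xz Xy) h)).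
- exact: seg_orient (proj1 (preserves_hulls_seg F Xx Xy Xz) h).
- by do 2!apply: orient0_rot; exact: seg_orient (proj1 (preserves_hulls_seg F Xy Xz Xx) h).
- exact: orient0_swapr (seg_orient (proj1 (preserves_hulls_seg F Xx Xz Xy) h)).
Qed.

Lemma preserves_hulls_btw f X Y x y z : preserves_hulls f X Y -> X x -> X y -> X z ->
  f y != f x -> f y != f z -> btw (f x) (f y) (f z) -> btw x y z.
Proof.
move=> F Xx Xy Xz n1 n2 /btw_seg/(preserves_hulls_seg F Xx Xz Xy)/seg_cases[e|e|//].
- by rewrite e eqxx in n1.
- by rewrite e eqxx in n2.
Qed.

Lemma preserves_hulls_sporadic f X Y : preserves_hulls f X Y -> sporadic_like Y -> sporadic_like X.
Proof.
move=> F [a0 [b0 [c0 [a0' [b0' [c0' [pw eY]]]]]]]; have [[ff finj fsurj] _] := F.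
have pre y : y \in [:: a0; b0; c0; a0'; b0'; c0'] -> exists2 x, X x & f x = y.
  by move=> hy; apply: fsurj; rewrite eY.
have [a Xa ea] : exists2 x, X x & f x = a0 by apply: pre; rewrite !inE eqxx.
have [b Xb eb] : exists2 x, X x & f x = b0 by apply: pre; rewrite !inE eqxx ?orbT.
have [c Xc ec] : exists2 x, X x & f x = c0 by apply: pre; rewrite !inE eqxx ?orbT.
have [a' Xa' ea'] : exists2 x, X x & f x = a0' by apply: pre; rewrite !inE eqxx ?orbT.
have [b' Xb' eb'] : exists2 x, X x & f x = b0' by apply: pre; rewrite !inE eqxx ?orbT.
have [c' Xc' ec'] : exists2 x, X x & f x = c0' by apply: pre; rewrite !inE eqxx ?orbT.
rewrite -ea -eb -ec -ea' -eb' -ec' in pw eY.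
have [[n1 n2 _ _] _ _] := pinwheel_facts pw.
have [[m1 m2 _ _] _ _] := pinwheel_facts (pinwheel_rot pw).
have [[l1 l2 _ _] _ _] := pinwheel_facts (pinwheel_rot (pinwheel_rot pw)).
case: pw => h1 h2 h3 n.
exists a, b, c, a', b', c'; split.
  split.
  - by apply: (preserves_hulls_btw F) h1; rewrite // eq_sym.
  - by apply: (preserves_hulls_btw F) h2; rewrite // eq_sym.
  - by apply: (preserves_hulls_btw F) h3; rewrite // eq_sym.
  - by apply: contra n => /eqP h; apply/eqP/(preserves_hulls_col F).
have inj u v : X u -> X v -> f u = f v -> u = v by move=> Xu Xv; apply: finj; rewrite in_setE.
rewrite eqEsubset; split=> x /=; last by rewrite !inE => /or4P[| | |/or3P[]] /eqP->.
move=> Xx; have := ff _ Xx; rewrite {1}eY /= !inE.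
by case/or4P => [| | |/or3P[]] /eqP/inj ->; rewrite ?eqxx ?orbT.
Qed.

(** [k] is the parameter of the point where [ss'] meets the line. An axis point between it and
    another axis point lies in the triangle of that point with [s] and [s']. *)
Lemma opposite_tri p q s s' : 0 < orient p q s -> orient p q s' < 0 ->
  exists k : R, forall t r : R, (k <= t /\ t <= r) \/ (r <= t /\ t <= k) ->
    tri s s' (lineat p q r) (lineat p q t).
Proof.
move=> hs hs'; have pq : p != q by apply: contraTneq hs => ->; rewrite orientaab ltxx.
pose m := orient p q s / (orient p q s - orient p q s').
have d0 : 0 < orient p q s - orient p q s' by lra.
have m0 : 0 <= m by rewrite divr_ge0 // ltW.
have m1 : m <= 1 by rewrite ler_pdivrMr //; lra.
pose c := (1 - m) *: s + m *: s'.
have cs : seg s s' c by exists m.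
have hc : orient p q c = 0 by rewrite orient_comb2 /m; field; rewrite gt_eqF.
have [k ek] := line_param pq hc; exists k => t r h.
have hseg : seg c (lineat p q r) (lineat p q t).
  rewrite ek; case: h => -[h1 h2]; first exact: seg_lineat.
  exact/segC/seg_lineat.
by apply: tri_sub (seg_tri hseg); [exact: seg_tri12|exact: seg_tri12|exact: tri3].
Qed.

(** Collinearity pulls back, but the preimages [b], [c] of [s], [s'] might end up on one side of the
    axis. Of three axis points, two lie weakly on one side of the point of [ss'] on the axis of [Y],
    and the nearer is in the triangle of [s], [s'] and the farther; pulled back, this contradicts
    [same_side_tri]. *)
Lemma preserves_hulls_thin f X Y : preserves_hulls f X Y -> thin Y -> thin X.
Proof.
move=> F [finY [p [q [s [s' [hs hs' hY]]]]]]; have [[ff finj fsurj] _] := F.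
have finX : finite_set X.
  have : finite_set (f @` X) by apply: sub_finite_set finY; move=> _ [x Xx <-]; exact: ff.
  by rewrite (eq_finite_set (inj_card_eq _)).
have pq : p != q by apply: contraTneq hs => ->; rewrite orientaab ltxx.
have uni y : exists b, forall x, X x -> f x = y -> x = b.
  have [[b [Xb e]]|n] := pselect (exists b, X b /\ f b = y); last first.
    (* The value 0 is arbitrary: [y] has no preimage in [X]. *)
    by exists 0 => x Xx e; case: n; exists x.
  by exists b => x Xx e'; apply: finj; rewrite ?in_setE // e e'.
have [b hb] := uni s; have [c hc] := uni s'.
have hX x : X x -> [\/ orient p q (f x) = 0, x = b | x = c].
  by move=> Xx; case: (hY _ (ff _ Xx)) => [h|/(hb _ Xx)|/(hc _ Xx)]; [constructor 1|constructor 2|constructor 3].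
have [[x [y [Xx Xy hx hy xy]]]|n] := pselect (exists x y,
    [/\ X x, X y, orient p q (f x) = 0, orient p q (f y) = 0 & x <> y]); last first.
  have [[a [Xa ha]]|n'] := pselect (exists a, X a /\ orient p q (f a) = 0); last first.
    apply: (@four_points_thin _ _ b b b c) => x Xx; case: (hX _ Xx) => [h|->|->].
    - by case: n'; exists x.
    - by rewrite !inE eqxx.
    - by rewrite !inE eqxx !orbT.
  apply: (@four_points_thin _ _ a a b c) => x Xx; case: (hX _ Xx) => [h|->|->].
  - suff -> : x = a by rewrite !inE eqxx.
    by apply: contrapT => xa; apply: n; exists x, a.
  - by rewrite !inE eqxx !orbT.
  - by rewrite !inE eqxx !orbT.
have xyn : x != y by apply/eqP.
have colX u v w : X u -> X v -> X w -> orient p q (f u) = 0 -> orient p q (f v) = 0 ->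
    orient p q (f w) = 0 -> orient u v w = 0.
  by move=> Xu Xv Xw hu hv hw; apply/(preserves_hulls_col F) => //; apply: line_col hu hv hw.
have hX' z : X z -> [\/ orient x y z = 0, z = b | z = c].
  by move=> Xz; case: (hX _ Xz) => [h|->|->]; [constructor 1; exact: colX|constructor 2|constructor 3].
have [[Xb eb]|nb] := pselect (X b /\ f b = s); last first.
  apply: (@thin1 _ _ x y c) => // z Xz; case: (hY _ (ff _ Xz)) => [h|e|/(hc _ Xz)]; [left; exact: colX| |by right].
  by case: nb; rewrite -(hb _ Xz e).
have [[Xc ec]|nc] := pselect (X c /\ f c = s'); last first.
  apply: (@thin1 _ _ x y b) => // z Xz; case: (hY _ (ff _ Xz)) => [h|/(hb _ Xz)|e]; [left; exact: colX|by right|].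
  by case: nc; rewrite -(hc _ Xz e).
have [h|h|h] := ltgtP (orient x y b * orient x y c) 0.
- exact: thinI h hX'.
- have [[z [Xz hz zx zy]]|n] := pselect (exists z, [/\ X z, orient p q (f z) = 0, z <> x & z <> y]); last first.
    apply: (@four_points_thin _ _ x y b c) => z Xz; case: (hX _ Xz) => [hz|->|->].
    + have [->|zx] := eqVneq z x; first by rewrite !inE eqxx.
      have [->|zy] := eqVneq z y; first by rewrite !inE eqxx orbT.
      by case: n; exists z; split=> //; exact/eqP.
    + by rewrite !inE eqxx !orbT.
    + by rewrite !inE eqxx !orbT.
  exfalso; have [k hk] := opposite_tri hs hs'.
  have bad u v (t r : R) : X u -> X v -> u <> v -> f u = lineat p q t -> f v = lineat p q r ->
      (k <= t /\ t <= r) \/ (r <= t /\ t <= k) -> False.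
    move=> Xu Xv uv eu ev /hk; rewrite -eu -ev -eb -ec => /(preserves_hulls_tri F Xb Xc Xv Xu) tr.
    have onu : orient p q (f u) = 0 by rewrite eu /lineat orient_comb2 orientaba orientabb !mulr0 addr0.
    have onv : orient p q (f v) = 0 by rewrite ev /lineat orient_comb2 orientaba orientabb !mulr0 addr0.
    apply: uv; apply: (@same_side_tri _ b c u v (orient x y) h _ _ _ tr).
    + exact: colX. + exact: colX.
    + by move=> *; rewrite orient_comb.
  have pair u v (t r : R) : X u -> X v -> u <> v -> f u = lineat p q t -> f v = lineat p q r ->
      (k <= t /\ k <= r) \/ (t <= k /\ r <= k) -> False.
    move=> Xu Xv uv eu ev; have vu : v <> u by move=> e; apply: uv.
    by have [tr|rt] := leP t r => -[[h1 h2]|[h1 h2]];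
      [apply: (bad u v t r)|apply: (bad v u r t)|apply: (bad v u r t)|apply: (bad u v t r)] => //;
      [left|right|left|right]; split=> //; exact: ltW.
  have [tx ex] := line_param pq hx; have [ty ey] := line_param pq hy; have [tz ez] := line_param pq hz.
  (* Pigeonhole: two of the three parameters lie on the same side of [k]. *)
  have [kx|kx] := leP k tx; have [ky|ky] := leP k ty; have [kz|kz] := leP k tz.
  + by apply: (pair x y tx ty) => //; left.
  + by apply: (pair x y tx ty) => //; left.
  + by apply: (pair z x tz tx) => //; left.
  + by apply: (pair z y tz ty) => //; right; split; exact: ltW.
  + by apply: (pair z y tz ty) => //; left.
  + by apply: (pair z x tz tx) => //; right; split; exact: ltW.
  + by apply: (pair x y tx ty) => //; right; split; exact: ltW.
  + by apply: (pair x y tx ty) => //; right; split; exact: ltW.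
- move/eqP: h; rewrite mulf_eq0 => /orP[/eqP h|/eqP h].
    apply: (@thin1 _ _ x y c) => // z /hX'[?|->|->]; [by left|by left|by right].
  apply: (@thin1 _ _ x y b) => // z /hX'[?|->|->]; [by left|by right|by left].
Qed.

End Equivalence.

Lemma equivalent_refl (R : realType) (d : nat) (X : set 'rV[R]_d) : equivalent X X.
Proof.
exists id; split; last by move=> A _; rewrite !image_id.
by split=> // x Xx; exists x.
Qed.

(** Nonemptiness excludes the empty set, whose lattice is finite although no configuration is empty.
    The forward direction shows that [X] itself is a configuration, so the identity serves as
    equivalence. *)
Theorem corollary4p10 (R : realType) (X : set 'rV[R]_2) (X0 : X !=set0) :
  finite_set (convex_lattice X) <->
  exists Y : set 'rV[R]_2, equivalent X Y /\
    [\/ exists n, linear_configuration n Y,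
        exists n, triangular_configuration n Y,
        exists p q, diamond_configuration p q Y \/
                    subdiamond_configuration p q Y |
        sporadic_configuration Y].
Proof.
split.
  move=> /finite_lattice_closure[P [finP ccP XP]]; exists X; split; first exact: equivalent_refl.
  have XtS : thin X \/ sporadic_like X.
    have P0 : P !=set0 by case: X0 => x /XP Px; exists x.
    have [/(thin_sub XP)|/(sub_sporadic XP)//] := cross_closed_classification ccP finP P0.
    by left.
  case: XtS => [/(thin_configuration X0)[h|h|h]|/sporadic_like_sporadic h].
  - by constructor 1.
  - by constructor 2.
  - by constructor 3.
  - by constructor 4.
case=> Y [[f F] /configuration_thin[]].
  move=> /(preserves_hulls_thin F)/thin_cross_closed[P [finP ccP XP]].
  exact: finite_convex_lattice XP.
move=> /(preserves_hulls_sporadic F) spX.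
have finX : finite_set X by case: spX => a [b [c [a' [b' [c' [_ ->]]]]]]; exact: finite_seq.
apply: finite_convex_lattice finX _ _ => //.
by move=> a b c d o Xa Xb Xc Xd /(sporadic_cross_free spX Xa Xb Xc Xd).
Qed.
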